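(* For every integer $k\ge 2$, there is a combinatorial algorithm that, given a graph $G$ with $n$ vertices and $m$ edges that contains no cycle of length $2\ell+1$ for every $\ell\in\{2,3,\dots,k\}$, decides whether $G$ contains a triangle in time $O(m+n^{1+2/k})$.
   Context: A ''combinatorial'' algorithm does not use fast matrix multiplication. $k$ is a constant. *)

(* Defs.v *)
From HB Require Import structures.
From mathcomp Require Import all_boot all_order all_algebra.
From mathcomp Require Import zify.
Set Implicit Arguments.
Unset Strict Implicit.
Unset Printing Implicit Defensive.

Section Graphs.
Variables (T : finType) (e : rel T).

Definition simple_graph : Prop := symmetric e /\ irreflexive e.

Definition edges : {set {set T}} := [set [set p.1; p.2] | p : T * T & e p.1 p.2].

(* For L >= 3 this is a (not necessarily induced) cycle of length L; for
   L = 2 an edge would qualify. *)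
Definition has_cycle_of_length (L : nat) : Prop :=
  exists2 c : seq T, size c = L & ucycle e c.

Definition has_triangle : bool :=
  [exists x, exists y, exists z, [&& e x y, e y z & e z x]].

End Graphs.

(* Random access machine, presented as structured programs: variables x_0, x_1,
   ... are the registers, and the memory consists of arrays a_0, a_1, ...; a
   program mentions only finitely many of either. The indices of variables and
   of arrays are fixed in the program text, only cells inside an array are
   addressed indirectly. *)
Record state := State { var : nat -> nat; arr : nat -> nat -> nat }.

Inductive instr :=
| Const (x c : nat)      (* x := c *)
| Move (x y : nat)       (* x := y *)
| Incr (x : nat)
| Decr (x : nat)         (* 0 stays 0 *)
| Add (x y z : nat)      (* x := y + z *)
| Sub (x y z : nat)      (* x := y - z, truncated *)
| Mul (x y z : nat)      (* x := y * z *)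
| Get (x a y : nat)     (* x := a[y] *)
| Put (a x y : nat).       (* a[x] := y *)

Inductive test :=
| Eq (x y : nat)
| Lt (x y : nat).

Inductive program :=
| Do (i : instr)
| Seq (P Q : program)
| If (b : test) (P Q : program)
| While (b : test) (P : program).

Definition set_var (s : state) (x v : nat) : state :=
  State (fun y => if y == x then v else var s y) (arr s).

Definition set_cell (s : state) (a j v : nat) : state :=
  State (var s)
        (fun a' j' => if (a' == a) && (j' == j) then v else arr s a' j').

Definition step (i : instr) (s : state) : state :=
  match i with
  | Const x c => set_var s x c
  | Move x y => set_var s x (var s y)
  | Incr x => set_var s x (var s x).+1
  | Decr x => set_var s x (var s x).-1
  | Add x y z => set_var s x (var s y + var s z)
  | Sub x y z => set_var s x (var s y - var s z)
  | Mul x y z => set_var s x (var s y * var s z)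
  | Get x a y => set_var s x (arr s a (var s y))
  | Put a x y => set_cell s a (var s x) (var s y)
  end.

Definition eval (b : test) (s : state) : bool :=
  match b with
  | Eq x y => var s x == var s y
  | Lt x y => var s x < var s y
  end.

(* exec P s t s' : started in s, P halts in s' after exactly t operations, where
   every instruction and every evaluation of a test counts as one operation. *)
Inductive exec : program -> state -> nat -> state -> Prop :=
| exec_do i s : exec (Do i) s 1 (step i s)
| exec_seq P Q s1 t1 s2 t2 s3 :
    exec P s1 t1 s2 -> exec Q s2 t2 s3 -> exec (Seq P Q) s1 (t1 + t2) s3
| exec_if_true b P Q s t s' :
    eval b s -> exec P s t s' -> exec (If b P Q) s t.+1 s'
| exec_if_false b P Q s t s' :
    ~~ eval b s -> exec Q s t s' -> exec (If b P Q) s t.+1 s'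
| exec_while_false b P s :
    ~~ eval b s -> exec (While b P) s 1 s
| exec_while_true b P s1 t1 s2 t2 s3 :
    eval b s1 -> exec P s1 t1 s2 -> exec (While b P) s2 t2 s3 ->
    exec (While b P) s1 (t1 + t2).+1 s3.

Definition combinatorial_instr (i : instr) : bool :=
  match i with Add _ _ _ | Sub _ _ _ | Mul _ _ _ => false | _ => true end.

(* A combinatorial program copies, compares, counts and follows indices, but has
   no ring arithmetic on the contents of its memory; this is how the informal
   requirement "does not use fast matrix multiplication" is made precise. Two
   consequences are proved below. By combinatorial_exec_bound, a run of t
   operations only produces numbers exceeding those of the program and of the
   input by at most t, so that unit cost is justified by words of logarithmic
   length. By combinatorial_no_fast_matmul, no combinatorial program (hence no
   part of one) multiplies N x N matrices with entries of O(log N) bits in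
   O(N^3) operations. *)
Fixpoint combinatorial (P : program) : bool :=
  match P with
  | Do i => combinatorial_instr i
  | Seq P Q | If _ P Q => combinatorial P && combinatorial Q
  | While _ P => combinatorial P
  end.

Fixpoint max_const (P : program) : nat :=
  match P with
  | Do (Const _ c) => c
  | Do _ => 0
  | Seq P Q | If _ P Q => maxn (max_const P) (max_const Q)
  | While _ P => max_const P
  end.

Definition bounded_by (M : nat) (s : state) : Prop :=
  (forall x, var s x <= M) /\ (forall a j, arr s a j <= M).

Lemma combinatorial_exec_bound (P : program) (s s' : state) (t M : nat) :
  combinatorial P -> max_const P <= M -> bounded_by M s ->
  exec P s t s' -> bounded_by (M + t) s'.
Proof.
move=> cP kP bs E; elim: E M cP kP bs => {P s t s'}.
- move=> i s M ci ki [bv ba]; split=> [y|a' j].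
  + case: i ci ki => //= [x c|x y'|x|x|x a y'|a x y'] _ ki; try case: ifP => _;
      try (by have := bv y; lia); try lia.
    * by have := bv y'; lia.
    * by have := bv x; lia.
    * by have := bv x; lia.
    * by have := ba a (var s y'); lia.
  + case: i ci ki => //= [x c|x y'|x|x|x a y'|a x y'] _ _; try case: ifP => _;
      try (by have := ba a' j; lia); by have := bv y'; lia.
- move=> P Q s1 t1 s2 t2 s3 _ IH1 _ IH2 M /= /andP[cP cQ]; rewrite geq_max.
  move=> /andP[kP kQ] bs; rewrite addnA; apply: IH2 => //; last exact: IH1.
  exact: leq_trans kQ (leq_addr _ _).
- move=> b P Q s t s' _ _ IH M /= /andP[cP cQ]; rewrite geq_max.
  move=> /andP[kP kQ] bs; have [hv ha] := IH _ cP kP bs.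
  by split=> *; rewrite addnS; apply: leqW; auto.
- move=> b P Q s t s' _ _ IH M /= /andP[cP cQ]; rewrite geq_max.
  move=> /andP[kP kQ] bs; have [hv ha] := IH _ cQ kQ bs.
  by split=> *; rewrite addnS; apply: leqW; auto.
- move=> b P s _ M _ _ [hv ha].
  by split=> *; rewrite addn1; apply: leqW; auto.
- move=> b P s1 t1 s2 t2 s3 _ _ IH1 _ IH2 M /= cP kP bs.
  have := IH2 (M + t1) cP (leq_trans kP (leq_addr _ _)) (IH1 _ cP kP bs).
  by rewrite -addnA => -[hv ha]; split=> *; rewrite addnS; apply: leqW; auto.
Qed.

Definition holds_matrix (N : nat) (s : state) (a : nat) (A : 'M[nat]_N) : Prop :=
  forall i j : 'I_N, arr s a (i * N + j) = A i j.

Definition multiplies_matrices (P : program) (T : nat -> nat) : Prop :=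
  forall (N : nat) (A B : 'M[nat]_N),
    (forall i j, A i j <= N ^ 2 /\ B i j <= N ^ 2) ->
    exists (s : state) (t : nat) (s' : state),
      [/\ bounded_by (N ^ 2) s, holds_matrix s 0 A /\ holds_matrix s 1 B,
          exec P s t s', holds_matrix s' 2 (A *m B)%R & t <= T N].

Lemma combinatorial_no_fast_matmul (P : program) (C : nat) :
  combinatorial P -> ~ multiplies_matrices P (fun N => C * N ^ 3).
Proof.
move=> cP mP; pose N := (max_const P + C + 2).+1.
pose A : 'M[nat]_N := const_mx (N ^ 2).
have [|s [t [s' [bs _ E hs tT]]]] := mP N A A; first by move=> i j; rewrite !mxE.
have kN : max_const P <= maxn (max_const P) (N ^ 2) by rewrite leq_maxl.
have bs' : bounded_by (maxn (max_const P) (N ^ 2)) s.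
  by case: bs => hv ha; split=> *; rewrite leq_max ?hv ?ha orbT.
have [_ /(_ 2 (0 * N + 0))] := combinatorial_exec_bound cP kN bs' E.
have -> : arr s' 2 (0 * N + 0) = N * (N ^ 2 * N ^ 2).
  rewrite (hs ord0 ord0) mxE (eq_bigr (fun=> N ^ 2 * N ^ 2)); last first.
    by move=> i _; rewrite !mxE.
  by rewrite [LHS](sum_nat_const 'I_N (N ^ 2 * N ^ 2)) card_ord.
have pN : 0 < N by [].
have CN : C + 2 <= N by rewrite /N; lia.
have PN : max_const P <= N ^ 2 by rewrite /N; nia.
rewrite (maxn_idPr PN) => le.
have : N * (N ^ 2 * N ^ 2) <= N ^ 2 + C * N ^ 3 by lia.
have -> : N * (N ^ 2 * N ^ 2) = N ^ 2 * N ^ 3 by rewrite -!expnD -expnS.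
have : N ^ 2 <= N ^ 3 by rewrite leq_pexp2l.
have : 0 < N ^ 3 by rewrite expn_gt0.
have : N <= N ^ 2 by rewrite -{1}(expn1 N) leq_pexp2l.
nia.
Qed.

(* Adjacency lists may come in any order. *)
Definition adjacency_lists (n : nat) (e : rel 'I_n) (adj : 'I_n -> seq 'I_n)
    : Prop :=
  forall v, uniq (adj v) /\ forall w, (w \in adj v) = e v w.

(* Initial memory: x_0 = n, x_1 = m, the neighbours of v are stored in the cells
   a_1[a_0[v]], ..., a_1[a_0[v+1] - 1], and everything else is 0. *)
Definition graph_input (n : nat) (e : rel 'I_n) (adj : 'I_n -> seq 'I_n)
    : state :=
  let lists := [seq [seq val w | w <- adj v] | v <- enum 'I_n] in
  let offsets := 0 :: scanl addn 0 [seq size l | l <- lists] in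
  State (nth 0 [:: n; #|edges e|])
        (fun a => nth 0 (nth [::] [:: offsets; flatten lists] a)).

Definition output (s : state) : nat := var s 0.

(* Main.v *)
Require Import Defs.
From mathcomp Require Import all_boot all_order all_algebra.
From mathcomp Require Import reals exp.
From mathcomp Require Import zify lra.
From Stdlib Require Import FunctionalExtensionality.
Set Implicit Arguments.
Unset Strict Implicit.
Unset Printing Implicit Defensive.
Import Order.TTheory GRing.Theory Num.Theory.

(* Run a breadth-first search from v on the edges that are still stored, with
   layers L_0, L_1, ... and B_j the union of L_0, ..., L_j. An edge inside a
   layer L_a with a < k closes an odd cycle of length at most 2k - 1 with the two
   tree paths, and the only odd cycles that short are triangles. If L_0, ...,
   L_(J-1) are scanned without meeting such an edge, then no triangle has a vertex
   in B_(J-2) (its three vertices would pairwise differ by exactly one layer), so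
   B_(J-2) can be killed. Moreover an arc from x in L_(J-1) to a vertex y of L_J
   with parent x' <> x lies in no surviving triangle x, y, z: then z is in L_J,
   and z, x, the tree paths up from x and x' and y form an odd cycle of length
   between 5 and 2J + 1. So every scanned arc is either a tree arc, paid for by the
   new vertex, or is deleted; all the searches together cost O(m + sum |B_J|).

   With d the least number such that d^k >= n, stop at the first J >= 1 with
   |B_J| <= d^J. Then J <= k, and |B_J| <= d^2 |B_(J-2)| is paid for by the killed
   vertices, except for J = 1, when nothing is killed but v has fewer than d arcs
   left. After one pass over all roots every surviving vertex has fewer than d arcs
   left, so in a second pass |B_2| <= d^2 holds at once and each root is killed.
   The total is O(m + n d^2), where d <= 2 n^(1/k). *)

(** * Search trees and short odd cycles *)

Section Tree.
Variables (E : rel nat) (k : nat).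
Hypothesis Esym : symmetric E.
Hypothesis Eirr : irreflexive E.
Hypothesis no_odd_cycle :
  forall l c, 2 <= l <= k -> size c = 2 * l + 1 -> ~ ucycle E c.

Definition triangle_edge x y := E x y /\ exists2 z, E y z & E z x.

Lemma triangle_edge_sym x y : triangle_edge x y -> triangle_edge y x.
Proof.
move=> [Exy [z Eyz Ezx]]; split; first by rewrite Esym.
by exists z; rewrite Esym.
Qed.

Variables (lay par : nat -> nat) (v : nat).
Hypothesis rootE : forall y, lay y = 2 -> y = v.
Hypothesis parE :
  forall y, 3 <= lay y -> (lay (par y)).+1 = lay y /\ E (par y) y.

Lemma tree_path a x x' : lay x = a.+2 -> lay x' = a.+2 -> x != x' ->
  exists t p, [/\ 1 <= t <= a, size p = 2 * t,
    path E x p /\ last x p = x', uniq (x :: p) &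
    all (fun z => lay z <= a.+2) (x :: p)].
Proof.
elim: a x x' => [|a IH] x x' lx lx' xx'.
  by rewrite (rootE lx) (rootE lx') eqxx in xx'.
have [lp Ep] : (lay (par x)).+1 = lay x /\ E (par x) x by apply: parE; rewrite lx.
have [lp' Ep'] : (lay (par x')).+1 = lay x' /\ E (par x') x'.
  by apply: parE; rewrite lx'.
have lpx : lay (par x) = a.+2 by lia.
have lpx' : lay (par x') = a.+2 by lia.
have low z p : all (fun z => lay z <= a.+2) p -> lay z = a.+3 -> z \notin p.
  by move=> /allP h lz; apply/negP => /h; rewrite lz ltnn.
have [pp|pp] := eqVneq (par x) (par x').
  exists 1, [:: par x; x']; rewrite /= !inE !andbT (Esym x) Ep {1}pp Ep' lpx lx lx'.
  split=> //; last by rewrite !leqnn leqnSn.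
  rewrite negb_or xx' andbT; apply/andP; split; apply/eqP => h.
    by move: lx; rewrite h lpx; lia.
  by move: lx'; rewrite -h lpx; lia.
have [t [p [tle sp [pathp lastp] up lowp]]] := IH _ _ lpx lpx' pp.
exists t.+1, (par x :: rcons p x'); split.
- by lia.
- by rewrite /= size_rcons sp; lia.
- by rewrite /= last_rcons rcons_path pathp lastp Ep' Esym Ep.
- rewrite -rcons_cons cons_uniq mem_rcons rcons_uniq inE negb_or xx' up.
  by rewrite !(low _ (par x :: p)).
- move: lowp; rewrite /= all_rcons lx lx' !leqnn /= => /andP[h1 h2].
  by rewrite leqW //=; apply: sub_all h2 => z /leqW.
Qed.

Lemma same_layer_triangle a x y : lay x = a.+2 -> lay y = a.+2 -> E x y ->
  a < k -> exists x' y', triangle_edge x' y'.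
Proof.
move=> lx ly Exy ak.
have xy : x != y by apply/eqP => h; rewrite h Eirr in Exy.
have [t [p [tle sp [pathp lastp] up _]]] := tree_path lx ly xy.
have uc : ucycle E (x :: p) by rewrite /ucycle /= rcons_path pathp lastp Esym Exy.
have [t1|t1] := eqVneq t 1; last first.
  by have [] := no_odd_cycle (l := t) (c := x :: p) _ _ uc => /=; lia.
move: sp pathp lastp; rewrite t1.
case: p {uc up} => [|z [|y' [|? ?]]] //= _ /and3P[Exz Ezy _] yE.
rewrite yE in Ezy.
by exists x, y; split=> //; exists z; rewrite Esym.
Qed.

Lemma unique_parent a x x' y z : lay x = a.+2 -> lay x' = a.+2 ->
  lay y = a.+3 -> lay z = a.+3 -> E x z -> E z y -> E x' y -> a.+2 <= k.+1 ->
  x = x'.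
Proof.
move=> lx lx' ly lz Exz Ezy Exy ak; apply/eqP/negPn/negP => xx'.
have [t [p [tle sp [pathp lastp] up lowp]]] := tree_path lx lx' xx'.
have low w : lay w = a.+3 -> w \notin x :: p.
  by move=> lw; apply/negP => /(allP lowp); rewrite lw ltnn.
have yz : y != z by apply/eqP => h; rewrite h Eirr in Ezy.
have uc : ucycle E (y :: z :: x :: p).
  rewrite /ucycle [cycle _ _]/= rcons_path pathp lastp Exy.
  rewrite (Esym y) Ezy (Esym z) Exz cons_uniq inE negb_or yz low //.
  by rewrite cons_uniq low.
by have [] := no_odd_cycle (l := t.+1) (c := y :: z :: x :: p) _ _ uc => /=; lia.
Qed.

End Tree.

(** * Invariants of the search *)

Definition upd (f : nat -> nat) i v := fun j => if j == i then v else f j.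

Lemma updE f i v : upd f i v i = v.
Proof. by rewrite /upd eqxx. Qed.

Lemma updN f i v j : j <> i -> upd f i v j = f j.
Proof. by move=> /eqP/negPf h; rewrite /upd h. Qed.

Lemma updP f i v j : (j = i /\ upd f i v j = v) \/ (j <> i /\ upd f i v j = f j).
Proof. by rewrite /upd; case: eqP; [left|right]. Qed.

Lemma sum_upd n f x v : x < n ->
  \sum_(i < n) upd f x v i + f x = \sum_(i < n) f i + v.
Proof.
move=> xn; rewrite (bigD1 (Ordinal xn)) // [in RHS](bigD1 (Ordinal xn)) //= updE.
rewrite (eq_bigr (fun i : 'I_n => f i)); first by lia.
by move=> i ix; rewrite updN // => h; case/eqP: ix; apply: val_inj.
Qed.

Section Bfs.
Variables (E : rel nat) (k n : nat) (off : nat -> nat).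
Hypothesis Esym : symmetric E.

Hypothesis Eirr : irreflexive E.
Hypothesis Elt : forall x y, E x y -> x < n.
Hypothesis no_odd_cycle :
  forall l c, 2 <= l <= k -> size c = 2 * l + 1 -> ~ ucycle E c.
Hypothesis off_mono : forall x y, x <= y -> off x <= off y.

Definition some_triangle := exists x y, triangle_edge E x y.

(* Here lay x is 0 for a living vertex, 1 for a killed one and, during a search,
   a + 2 for a vertex of layer a; fo is the flag raised by an edge inside a layer.
   Arcs are deleted from one end only, so the stored arcs need not be symmetric. *)
Record root_inv (lay ce en : nat -> nat) (fo : nat) : Prop := RootInv {
  ri_ptr : forall x, x < n -> off x <= en x <= off x.+1;
  ri_cell : forall x i, x < n -> off x <= i < en x -> E x (ce i);
  ri_lay : forall x, lay x <= 1;
  ri_found : fo <= 1 /\ (fo = 1 -> some_triangle);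
  ri_tri : fo = 0 -> forall x y, triangle_edge E x y ->
    lay x = 0 /\ exists2 i, off x <= i < en x & ce i = y }.

(* The state of a search from v that has begun to scan the first sc vertices of the
   queue q of length tl; the queue positions below b0, in [b0, b1), in [b1, b2) and
   from b2 on hold the vertices with lay < cur - 1, = cur - 1, = cur, = cur + 1. The
   arcs of x occupy the cells [off x, en x), those in [off x, lo x) have been
   scanned and kept; lo is not part of the memory. *)
Record bfs_inv (dead : pred nat) (en0 : nat -> nat) (v b0 b1 b2 cur sc : nat)
    (lay q par ce en lo : nat -> nat) (fo tl : nat) : Prop := BfsInv {
  bi_ptr : forall x, x < n ->
    [/\ off x <= lo x, lo x <= en x, en x <= off x.+1 & en x <= en0 x];
  bi_cell : forall x i, x < n -> off x <= i < en x -> E x (ce i);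
  bi_queue : forall i, i < tl -> q i < n;
  bi_inj : forall i j, i < tl -> j < tl -> q i = q j -> i = j;
  bi_mem : forall y, 2 <= lay y -> exists2 i, i < tl & q i = y;
  bi_pos : [/\ b0 <= b1, b1 <= b2, b2 <= tl, 0 < tl & 2 <= cur <= k.+2 /\ sc <= tl];
  bi_lay : forall i, i < tl ->
    [/\ 2 <= lay (q i), i < b0 -> (lay (q i)).+1 < cur,
        b0 <= i < b1 -> (lay (q i)).+1 = cur, b1 <= i < b2 -> lay (q i) = cur &
        b2 <= i -> lay (q i) = cur.+1];
  bi_dead : forall y, (lay y == 1) = dead y;
  bi_root : q 0 = v /\ forall y, lay y = 2 -> y = v;
  bi_tree : forall y, 3 <= lay y -> (lay (par y)).+1 = lay y /\
    exists2 i, off (par y) <= i < lo (par y) & ce i = y;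
  bi_found : fo <= 1 /\ (fo = 1 -> some_triangle);
  bi_tri : fo = 0 -> forall x y, triangle_edge E x y -> ~~ dead x /\
    ([/\ exists2 i, i < sc & q i = x, 2 <= lay y, lay y <= (lay x).+1 &
         lay y <> lay x]
     \/ exists2 i, lo x <= i < en x & ce i = y) }.

Definition scanned (q en lo : nat -> nat) h :=
  (forall i, i < h -> lo (q i) = en (q i)) /\
  (forall x, (forall i, i < h -> q i <> x) -> lo x = off x).

Lemma segment_disjoint x y i :
  off x <= i < off x.+1 -> off y <= i < off y.+1 -> x = y.
Proof.
move=> hx hy; case: (ltngtP x y) => // h.
  by have := off_mono h; lia.
by have := off_mono h; lia.
Qed.

Lemma bfs_start lay q par ce en fo v : root_inv lay ce en fo -> v < n ->
  lay v = 0 ->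
  bfs_inv (fun y => lay y == 1) en v 0 0 1 2 0 (upd lay v 2) (upd q 0 v) par ce
    en off fo 1 /\ scanned (upd q 0 v) en off 0.
Proof.
move=> [ptr cell lay1 found tri] vn lv.
split; last by split.
split=> //.
- by move=> x xn; have /andP[h1 h2] := ptr x xn; split.
- by move=> i; rewrite ltnS leqn0 => /eqP->; rewrite updE.
- by move=> i j; lia.
- move=> y; case: (updP lay v 2 y) => -[hy ->]; last by have := lay1 y; lia.
  by move=> _; exists 0 => //; rewrite updE.
- by move=> i; rewrite ltnS leqn0 => /eqP->; rewrite !updE; split=> //; lia.
- by move=> y; case: (updP lay v 2 y) => -[hy ->] //; rewrite hy lv.
- split; first by rewrite updE.
  by move=> y; case: (updP lay v 2 y) => -[hy ->] //; have := lay1 y; lia.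
- by move=> y; case: (updP lay v 2 y) => -[hy ->] //; have := lay1 y; lia.
- move=> fo0 x y /(tri fo0)[lx ex]; split; first by rewrite lx.
  by right.
Qed.

Section Step.
Variables (dead : pred nat) (en0 : nat -> nat) (v b0 b1 b2 cur sc : nat).
Variables (lay q par ce en lo : nat -> nat) (fo tl : nat).
Hypothesis inv : bfs_inv dead en0 v b0 b1 b2 cur sc lay q par ce en lo fo tl.

Lemma bfs_inv_sc sc' : sc <= sc' <= tl ->
  bfs_inv dead en0 v b0 b1 b2 cur sc' lay q par ce en lo fo tl.
Proof.
move=> le; case: inv => h1 h2 h3 h4 h5 h6 h7 h8 h9 h10 h11 h12; split=> //.
  by case: h6; split=> //; lia.
move=> f0 x y /(h12 f0)[dx [[[i ii qi] ? ? ?]|h]]; split=> //; last by right.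
by left; split=> //; exists i => //; lia.
Qed.

Lemma bfs_next_layer : cur < k.+2 ->
  bfs_inv dead en0 v b1 b2 tl cur.+1 sc lay q par ce en lo fo tl.
Proof.
case: inv => h1 h2 h3 h4 h5 h6 h7 h8 h9 h10 h11 h12 ck; split=> //.
  by case: h6; split; lia.
by move=> i itl; have [? ? ? ? ?] := h7 i itl; split; lia.
Qed.

Lemma bfs_size : tl <= n.
Proof.
rewrite -(size_iota 0 tl) -(size_map q) -(size_iota 0 n).
apply: uniq_leq_size.
  rewrite map_inj_in_uniq ?iota_uniq // => i j; rewrite !mem_iota !add0n.
  exact: bi_inj inv _ _.
move=> y /mapP[i]; rewrite !mem_iota !add0n => /(bi_queue inv) qn ->.
exact: qn.
Qed.

Variables x h : nat.
Hypotheses (hb2 : b1 <= h < b2) (qh : q h = x) (hsc : h < sc).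
Hypothesis lox : lo x < en x.

Let htl : h < tl. Proof. by case: (bi_pos inv); lia. Qed.
Let xn : x < n. Proof. by rewrite -qh (bi_queue inv). Qed.
Let lx : lay x = cur. Proof. by case: (bi_lay inv htl); rewrite qh; lia. Qed.

Lemma bfs_keep y : y = ce (lo x) -> lay y = 0 ->
  bfs_inv dead en0 v b0 b1 b2 cur sc (upd lay y cur.+1) (upd q tl y)
    (upd par y x) ce en (upd lo x (lo x).+1) fo tl.+1.
Proof.
move=> yE ly; move: lx => lxc.
case: inv => h1 h2 h3 h4 h5 h6 h7 h8 h9 h10 h11 h12.
have [bb0 bb1 bb2 tl0 [cur2 sctl]] := h6.
have Exy : E x y by rewrite yE; apply: h2 => //; have [] := h1 x xn; lia.
have yn : y < n by apply: Elt; rewrite Esym; exact: Exy.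
have qy i : i < tl -> q i <> y by move=> /h7[]; move=> + _ _ _ _ hq; rewrite hq ly.
have xy : x <> y by rewrite -qh; exact: qy.
split=> //.
- move=> z zn; have [? ? ? ?] := h1 z zn.
  by case: (updP lo x (lo x).+1 z) => -[hz ->] //; subst z; split; lia.
- by move=> i ii; case: (updP q tl y i) => -[hi ->] //; apply: h3; lia.
- move=> i j ii jj; case: (updP q tl y i) => -[hi ->];
    case: (updP q tl y j) => -[hj ->] // hq.
  + by rewrite hi hj.
  + by case: (@qy j) => //; lia.
  + by case: (@qy i) => //; lia.
  + by apply: h4 => //; lia.
- move=> z; case: (updP lay y cur.+1 z) => -[hz ->] hl.
    by exists tl; rewrite ?updE.
  have [i ii <-] := h5 _ hl; exists i; first lia.
  by rewrite updN //; lia.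
- by split; lia.
- move=> i ii; case: (updP q tl y i) => -[hi ->].
    by rewrite updE; split; lia.
  have itl : i < tl by lia.
  by rewrite updN; [exact: h7 | exact: qy].
- move=> z; case: (updP lay y cur.+1 z) => -[hz ->] //.
  by rewrite hz -h8 ly; lia.
- case: h9 => q0 root; split; first by rewrite updN //; lia.
  by move=> z; case: (updP lay y cur.+1 z) => -[hz ->] //; [lia | exact: root].
- move=> z; case: (updP lay y cur.+1 z) => -[hz ->] hl.
    rewrite hz !updE updN // lxc; split=> //.
    by exists (lo x) => //; have [] := h1 x xn; lia.
  have [lp [i ii ci]] := h10 z hl.
  have py : par z <> y by move=> hp; move: lp; rewrite hp ly; lia.
  rewrite (updN _ _ hz) (updN _ _ py); split=> //; exists i => //.
  by case: (updP lo x (lo x).+1 (par z)) => -[hp ->] //; rewrite -hp; lia.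
- move=> f0 a b Tab; have [da [[[i ii qi] lb1 lb2 lb3]|[i ii ci]]] := h12 f0 a b Tab;
    split=> //.
    left; have itl : i < tl by lia.
    have ay : a <> y by rewrite -qi; exact: qy.
    have bY : b <> y by move=> bY; move: lb1; rewrite bY ly.
    by rewrite (updN _ _ ay) (updN _ _ bY); split=> //; exists i; rewrite ?updN //; lia.
  case: (updP lo x (lo x).+1 a) => -[ax ->]; last by right; exists i.
  have [ilo|ilo] := eqVneq i (lo x); last first.
    by right; exists i => //; rewrite ax in ii *; lia.
  have bY : b = y by rewrite -ci ilo.
  left; rewrite ax bY updE (updN _ _ xy) lxc; split=> //; try lia.
  by exists h => //; rewrite updN //; lia.
Qed.

Lemma bfs_delete y : y = ce (lo x) -> lay y <> 0 -> cur < k.+2 ->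
  bfs_inv dead en0 v b0 b1 b2 cur sc lay q par
    (upd ce (lo x) (ce (en x).-1)) (upd en x (en x).-1) lo
    (if lay y == cur then 1 else fo) tl.
Proof.
move=> yE ly ck; move: lx => lxc.
case: inv => h1 h2 h3 h4 h5 h6 h7 h8 h9 h10 h11 h12.
have [bb0 bb1 bb2 tl0 [cur2 sctl]] := h6.
have [xp1 xp2 xp3 xp4] := h1 x xn.
have Exy : E x y by rewrite yE; apply: h2 => //; lia.
have ceN a i : off a <= i < off a.+1 -> a <> x ->
    upd ce (lo x) (ce (en x).-1) i = ce i.
  move=> ia ax; apply: updN => ilo; apply: ax.
  by apply: (segment_disjoint ia); lia.
have parn z : 3 <= lay z -> par z < n.
  move=> hz; have [lp _] := h10 z hz; have [|i /h3 + <-] := h5 (par z) => //; lia.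
split=> //.
- move=> z zn; have [? ? ? ?] := h1 z zn.
  by case: (updP en x (en x).-1 z) => -[hz ->] //; subst z; split; lia.
- move=> a i an; case: (updP en x (en x).-1 a) => -[ax ->] ii.
    rewrite ax; case: (updP ce (lo x) (ce (en x).-1) i) => -[ilo ->].
      by apply: h2 => //; lia.
    by rewrite ax in ii; apply: h2 => //; lia.
  by have [? ? ? ?] := h1 a an; rewrite (ceN a) //; [exact: h2 | lia].
- move=> z hz; have [lp [i ii ci]] := h10 z hz; split=> //; exists i => //.
  have [? ? ? ?] := h1 _ (parn _ hz).
  have [px|px] := eqVneq (par z) x; first by rewrite px in ii; rewrite updN //; lia.
  by rewrite (ceN (par z)) //; [lia | exact/eqP].
- case: eqP => [lyc|_] //; split=> // _.
  have tE z : 3 <= lay z -> (lay (par z)).+1 = lay z /\ E (par z) z.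
    move=> hz; have [lp [i ii ci]] := h10 z hz; split=> //.
    have [? ? ? ?] := h1 _ (parn _ hz); have := h2 _ i (parn _ hz).
    by rewrite ci; apply; lia.
  have cE : cur = (cur - 2).+2 by lia.
  by apply: (same_layer_triangle Esym Eirr no_odd_cycle (proj2 h9) tE
    (a := cur - 2) (x := x) (y := y)) => //; lia.
- case: eqP => [lyc|lyc] //.
  move=> f0 a b Tab; have [da [?|[i ii ci]]] := h12 f0 a b Tab;
    split=> //; first by left.
  have an : a < n by case: Tab => Eab _; exact: Elt Eab.
  have [ap1 ap2 ap3 ap4] := h1 a an.
  case: (updP en x (en x).-1 a) => -[ax ->]; last first.
    by right; exists i => //; rewrite (ceN a) //; lia.
  rewrite ax in ii *.
  have [ilo|ilo] := eqVneq i (lo x); last first.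
    have [ie|ie] := eqVneq i (en x).-1.
      by right; exists (lo x); rewrite ?updE -?ie //; lia.
    by right; exists i; rewrite ?updN //; [lia | exact/eqP].
  have bY : b = y by rewrite -ci ilo.
  have db : ~~ dead b by case: (h12 f0 b a (triangle_edge_sym Esym Tab)).
  left; rewrite bY lxc; split=> //; first by exists h.
    by move: db; rewrite -h8 bY; lia.
  have ly2 : 2 <= lay y by move: db; rewrite -h8 bY; lia.
  have [j jtl qj] := h5 y ly2.
  by have := h7 j jtl; rewrite qj => -[]; lia.
Qed.

End Step.

Lemma bfs_finish dead en0 v b0 b1 b2 cur sc lay q par ce en lo fo tl lay' :
  bfs_inv dead en0 v b0 b1 b2 cur sc lay q par ce en lo fo tl ->
  scanned q en lo b1 -> sc <= b1 ->
  (forall i, i < b0 -> lay' (q i) = 1) ->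
  (forall i, b0 <= i < tl -> lay' (q i) = 0) ->
  (forall y, (forall i, i < tl -> q i <> y) -> lay' y = lay y) ->
  root_inv lay' ce en fo.
Proof.
move=> [h1 h2 h3 h4 h5 h6 h7 h8 h9 h10 h11 h12] [sc1 sc2] scb1 k1 k2 k3.
have [bb0 bb1 bb2 tl0 [cur2 sctl]] := h6.
have parn z : 3 <= lay z -> par z < n.
  move=> hz; have [lp _] := h10 z hz; have [|i /h3 + <-] := h5 (par z) => //; lia.
have visP y : (exists2 i, i < tl & q i = y) \/ (lay y < 2 /\ lay' y = lay y).
  have [l2|l2] := leqP 2 (lay y); first by left; exact: h5.
  right; split=> //; apply: k3 => i itl qi.
  by have [] := h7 i itl; rewrite qi; lia.
(* The layers of the ends of a triangle edge between scanned vertices differ by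
   exactly one, so a triangle through a killed vertex would violate parity. *)
have low_edge : fo = 0 -> forall x y, triangle_edge E x y -> 2 <= lay x < cur ->
    [/\ 2 <= lay y, lay y <= (lay x).+1 & lay y <> lay x].
  move=> f0 x y Txy lx; have [_ [[_]|[i]]] := h12 f0 x y Txy; first by split.
  have [|j jtl qj] := h5 x; first lia.
  have jb1 : j < b1 by have := h7 j jtl; rewrite qj => -[]; lia.
  by rewrite -qj sc1 //; lia.
have killed : fo = 0 -> forall x y, triangle_edge E x y -> 2 <= lay x ->
    (lay x).+1 < cur -> False.
  move=> f0 x y [Exy [z Eyz Ezx]] lx lxc.
  have Txy : triangle_edge E x y by split=> //; exists z.
  have Tyz : triangle_edge E y z by split=> //; exists x.
  have Txz : triangle_edge E x z.
    by split; [rewrite Esym | exists y; rewrite Esym].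
  have [|y2 yx1 yx2] := low_edge f0 _ _ Txy; first lia.
  have [|z2 zx1 zx2] := low_edge f0 _ _ Txz; first lia.
  have [|_ yz1 yz2] := low_edge f0 _ _ Tyz; first lia.
  have [|_ zy1 zy2] := low_edge f0 _ _ (triangle_edge_sym Esym Tyz); first lia.
  have [|_ xy1 _] := low_edge f0 _ _ (triangle_edge_sym Esym Txy); first lia.
  have [|_ xz1 _] := low_edge f0 _ _ (triangle_edge_sym Esym Txz); first lia.
  lia.
split=> //.
- by move=> x /h1[]; lia.
- move=> y; case: (visP y) => [[i itl <-]|[l2 ->]]; last lia.
  by have [ib|ib] := ltnP i b0; [rewrite k1 | rewrite k2 ?ib].
- move=> f0 x y Txy; have [dx hx] := h12 f0 x y Txy.
  have Exy : E x y by case: Txy.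
  have xn := Elt Exy; have [ox1 ox2 ox3 ox4] := h1 x xn.
  move: dx; rewrite -h8 => dx; split.
    case: (visP x) => [[i itl qx]|[l2 ->]]; last lia.
    have [ib|ib] := ltnP i b0; last by rewrite -qx k2 ?ib.
    have [l2 l3 _ _ _] := h7 i itl.
    by case: (killed f0 _ _ Txy); rewrite -qx //; apply: l3.
  case: hx => [[[i ii qx] ly1 ly2 ly3]|[i ii ci]]; last by exists i => //; lia.
  have itl : i < tl by lia.
  have [lx2 l1 l2' _ _] := h7 i itl; rewrite qx in lx2 l1 l2'.
  have [ib|ib] := ltnP i b0; first by case: (killed f0 _ _ Txy) => //; apply: l1.
  have lx : (lay x).+1 = cur by apply: l2'; lia.
  have next w : triangle_edge E x w -> lay w = cur.
    move=> Txw; have [|w2 w3 w4] := low_edge f0 _ _ Txw; first lia.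
    have [wc|wc] := ltnP (lay w).+1 cur; last lia.
    by case: (killed f0 _ _ (triangle_edge_sym Esym Txw)).
  have lyc := next _ Txy.
  have [_ [z Eyz Ezx]] := Txy.
  have lzc : lay z = cur.
    by apply: next; split; [rewrite Esym | exists y; rewrite Esym].
  have ly3' : 3 <= lay y by lia.
  have [lp [j jj cj]] := h10 y ly3'.
  have tE w : 3 <= lay w -> (lay (par w)).+1 = lay w /\ E (par w) w.
    move=> hw; have [lpw [j' jj' cj']] := h10 w hw; split=> //.
    have [? ? ? ?] := h1 _ (parn _ hw); have := h2 _ j' (parn _ hw).
    by rewrite cj'; apply; lia.
  have xE : x = par y.
    have cE : cur = (cur - 3).+3 by lia.
    apply: (unique_parent Esym Eirr no_odd_cycle (proj2 h9) tE
      (a := cur - 3) (y := y) (z := z)); try (by rewrite 1?Esym); try lia.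
    by have [] := tE y ly3'.
  by exists j => //; rewrite -xE in jj; lia.
Qed.

End Bfs.

(** * Running time logic for programs *)

Definition spec (P : program) (s : state) (Q : nat -> state -> Prop) :=
  exists t s', exec P s t s' /\ Q t s'.

Definition target (i : instr) : option nat :=
  match i with
  | Const x _ | Move x _ | Incr x | Decr x | Add x _ _ | Defs.Sub x _ _ | Mul x _ _
  | Get x _ _ => Some x
  | Put _ _ _ => None
  end.

Fixpoint writes_var (P : program) (x : nat) : bool :=
  match P with
  | Do i => target i == Some x
  | Seq P Q | If _ P Q => writes_var P x || writes_var Q x
  | While _ P => writes_var P x
  end.

Fixpoint writes_arr (P : program) (a : nat) : bool :=
  match P with
  | Do (Put b _ _) => a == b
  | Do _ => false
  | Seq P Q | If _ P Q => writes_arr P a || writes_arr Q a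
  | While _ P => writes_arr P a
  end.

Definition frame (P : program) (s s' : state) : Prop :=
  (forall x, ~~ writes_var P x -> var s' x = var s x) /\
  (forall a, ~~ writes_arr P a -> arr s' a = arr s a).

Lemma frame_trans P s1 s2 s3 : frame P s1 s2 -> frame P s2 s3 -> frame P s1 s3.
Proof.
move=> [v1 a1] [v2 a2]; split=> [x|a] h; first by rewrite v2 // v1.
by rewrite a2 // a1.
Qed.

Lemma exec_frame P s t s' : exec P s t s' -> frame P s s'.
Proof.
elim=> {P s t s'}.
- move=> i s; split=> [x|a].
    case: i => //= [y c|y z|y|y|y z w|y z w|y z w|y b z] h; rewrite ifN //;
      by apply: contra h => /eqP->.
  by case: i => //= b x y /negPf->.
- move=> P Q s1 t1 s2 t2 s3 _ [v1 a1] _ [v2 a2]; split=> [x|a] /=;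
    rewrite negb_or => /andP[h1 h2]; first by rewrite v2 // v1.
  by rewrite a2 // a1.
- by move=> b P Q s t s' _ _ [v1 a1]; split=> [x|a] /=;
    rewrite negb_or => /andP[h1 h2]; [apply: v1 | apply: a1].
- by move=> b P Q s t s' _ _ [v1 a1]; split=> [x|a] /=;
    rewrite negb_or => /andP[h1 h2]; [apply: v1 | apply: a1].
- by [].
- by move=> b P s1 t1 s2 t2 s3 _ _ [v1 a1] _ /=; apply: frame_trans; split.
Qed.

Lemma spec_conseq P s (Q Q' : nat -> state -> Prop) : spec P s Q ->
  (forall t s', frame P s s' -> Q t s' -> Q' t s') -> spec P s Q'.
Proof.
move=> [t [s' [e q]]] h; exists t, s'; split=> //.
by apply: h => //; exact: exec_frame e.
Qed.

Lemma spec_do i s (Q : nat -> state -> Prop) : Q 1 (step i s) -> spec (Do i) s Q.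
Proof. by move=> q; exists 1, (step i s); split=> //; constructor. Qed.

Lemma spec_seq P R s (Q : nat -> state -> Prop) :
  spec P s (fun t s' => spec R s' (fun t' => Q (t + t'))) -> spec (Seq P R) s Q.
Proof.
move=> [t [s' [e [t' [s'' [e' q]]]]]]; exists (t + t'), s''; split=> //.
exact: exec_seq e e'.
Qed.

Ltac step_instr := apply: spec_seq; apply: spec_do; rewrite [step _ _]/=.

Lemma spec_if b P R s (Q : nat -> state -> Prop) :
  (eval b s -> spec P s (fun t => Q t.+1)) ->
  (~~ eval b s -> spec R s (fun t => Q t.+1)) -> spec (If b P R) s Q.
Proof.
case: (boolP (eval b s)) => [bs /(_ isT)[t [s' [e q]]] _|bs _ /(_ isT)[t [s' [e q]]]].
  by exists t.+1, s'; split=> //; apply: exec_if_true.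
by exists t.+1, s'; split=> //; apply: exec_if_false.
Qed.

(* The invariant I speaks of the time already spent, and the body may use that the
   loop leaves everything it does not assign as it was. *)
Lemma spec_while b P (I : nat -> state -> Prop) (mu : state -> nat) s0 :
  I 0 s0 ->
  (forall t s, frame P s0 s -> I t s -> eval b s ->
    spec P s (fun t1 s1 => mu s1 < mu s /\ I (t + t1).+1 s1)) ->
  spec (While b P) s0 (fun t s => [/\ I t.-1 s, 0 < t & ~~ eval b s]).
Proof.
move=> I0 body.
suff loop m : forall t s, mu s < m -> frame P s0 s -> I t s ->
    spec (While b P) s (fun t1 s1 => [/\ I (t + t1).-1 s1, 0 < t1 & ~~ eval b s1]).
  by have := loop (mu s0).+1 0 s0 (ltnSn _) _ I0; apply.
elim: m => // m IH t s mus fr It.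
case: (boolP (eval b s)) => bs; last first.
  by exists 1, s; split; [constructor | rewrite addn1].
have [t1 [s1 [e1 [mu1 I1]]]] := body t s fr It bs.
have mu1m : mu s1 < m by lia.
have [t2 [s2 [e2 [I2 t20 bs2]]]] := IH _ s1 mu1m (frame_trans fr (exec_frame e1)) I1.
exists (t1 + t2).+1, s2; split; first exact: exec_while_true e1 e2.
by split=> //; have -> : t + (t1 + t2).+1 = (t + t1).+1 + t2 by lia.
Qed.

Lemma upd_id f x v : f x = v -> upd f x v = f.
Proof.
by move=> <-; apply: functional_extensionality => i; rewrite /upd; case: eqP => // ->.
Qed.

Lemma upd_upd f x v w : upd (upd f x v) x w = upd f x w.
Proof.
by apply: functional_extensionality => i; rewrite /upd; case: eqP.
Qed.

(** * The program *)

(* vN: n; vF: triangle found; vV: root; vJ: layers scanned so far; vB0, vB1, vB2: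
   |B_(j-2)|, |B_(j-1)|, |B_j|; vH, vT: head and tail of the queue; vX: vertex being
   scanned; vR, vE: current and end cell of its list; vY: neighbour; vL: lay of vY;
   vC, vS: lay of the current and of the next layer; vP: bound on |B_j|; vO = 1;
   vZ = 0; vK = k; vD: d; vQ, vI, vM: accumulator and counters of a product. *)
Local Notation vN := 0 (only parsing).
Local Notation vF := 2 (only parsing).
Local Notation vV := 3 (only parsing).
Local Notation vJ := 4 (only parsing).
Local Notation vB0 := 5 (only parsing).
Local Notation vB1 := 6 (only parsing).
Local Notation vB2 := 7 (only parsing).
Local Notation vH := 8 (only parsing).
Local Notation vT := 9 (only parsing).
Local Notation vX := 10 (only parsing).
Local Notation vR := 11 (only parsing).
Local Notation vE := 12 (only parsing).
Local Notation vY := 13 (only parsing).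
Local Notation vL := 14 (only parsing).
Local Notation vC := 15 (only parsing).
Local Notation vS := 16 (only parsing).
Local Notation vP := 17 (only parsing).
Local Notation vO := 18 (only parsing).
Local Notation vZ := 19 (only parsing).
Local Notation vK := 20 (only parsing).
Local Notation vD := 21 (only parsing).
Local Notation vQ := 22 (only parsing).
Local Notation vI := 23 (only parsing).
Local Notation vM := 24 (only parsing).

Local Notation aOff := 0 (only parsing).
Local Notation aCell := 1 (only parsing).
Local Notation aEnd := 2 (only parsing).
Local Notation aLay := 3 (only parsing).
Local Notation aQ := 4 (only parsing).
Local Notation aPow := 5 (only parsing).
Local Notation aPar := 6 (only parsing).

Local Notation "P ;; Q" := (Seq P Q) (at level 60, right associativity).
#[local] Coercion Do : instr >-> program.
Definition skip : program := Move vF vF.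

Definition scan_cell : program :=
  Get vY aCell vR ;; Get vL aLay vY ;;
  If (Eq vL vZ)
    (Put aLay vY vS ;; Put aQ vT vY ;; Put aPar vY vX ;; Incr vT ;; Incr vR)
    (If (Eq vL vC) (Const vF 1) skip ;; Decr vE ;; Get vY aCell vE ;; Put aCell vR vY).

Definition scan_vertex : program :=
  Get vX aQ vH ;; Get vR aOff vX ;; Get vE aEnd vX ;;
  While (Lt vR vE) scan_cell ;; Put aEnd vX vE ;; Incr vH.

Definition scan_layer : program := While (Lt vH vB2) scan_vertex.

Definition mark_until (b c : nat) : program :=
  While (Lt vH b) (Get vX aQ vH ;; Put aLay vX c ;; Incr vH).

Definition cluster : program :=
  Const vC 2 ;; Const vS 3 ;; Put aLay vV vC ;; Put aQ vZ vV ;;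
  Const vB0 0 ;; Const vB1 0 ;; Const vB2 1 ;; Const vJ 0 ;; Const vH 0 ;;
  Const vT 1 ;; Get vP aPow vJ ;;
  While (Lt vP vB2)
    (scan_layer ;; Move vB0 vB1 ;; Move vB1 vB2 ;; Move vB2 vT ;;
     Incr vJ ;; Incr vC ;; Incr vS ;; Get vP aPow vJ) ;;
  Const vH 0 ;; mark_until vB0 vO ;; mark_until vB2 vZ.

Definition pass : program :=
  Const vV 0 ;;
  While (Lt vV vN) (Get vL aLay vV ;; If (Eq vL vZ) cluster skip ;; Incr vV).

Definition powers : program :=
  While (Lt vP vN)
    (Incr vD ;; Const vP 1 ;; Const vJ 0 ;;
     While (Lt vJ vK)
       (Const vQ 0 ;; Const vI 0 ;;
        While (Lt vI vP)
          (Const vM 0 ;; While (Lt vM vD) (Incr vQ ;; Incr vM) ;; Incr vI) ;;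
        Move vP vQ ;; Incr vJ ;; Put aPow vJ vP)).

Definition init_ends : program :=
  While (Lt vV vN)
    (Move vX vV ;; Incr vV ;; Get vE aOff vV ;; Put aEnd vX vE).

(* The entry 0 of aPow stays 0, so that each search scans at least its root. Setting
   the entry 1 to 0 as well forces the second pass to scan two layers. *)
Definition triangle_program (k : nat) : program :=
  Const vO 1 ;; Const vK k ;; init_ends ;; powers ;; pass ;;
  Const vX 1 ;; Put aPow vX vZ ;; pass ;; Move vN vF.

Lemma combinatorial_triangle_program k : combinatorial (triangle_program k).
Proof. by []. Qed.

(** * Correctness and running time of the program *)

Section Scan.
Variables (E : rel nat) (k n : nat) (off : nat -> nat).
Hypothesis Esym : symmetric E.
Hypothesis Eirr : irreflexive E.
Hypothesis Elt : forall x y, E x y -> x < n.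
Hypothesis no_odd_cycle :
  forall l c, 2 <= l <= k -> size c = 2 * l + 1 -> ~ ucycle E c.
Hypothesis off_mono : forall x y, x <= y -> off x <= off y.

Definition env (s : state) : Prop :=
  [/\ var s vN = n, var s vZ = 0, var s vO = 1 &
      forall x, x < n -> arr s aOff x = off x].

Definition bfs_at (dead : pred nat) en0 v b0 b1 b2 cur sc lo (s : state) : Prop :=
  bfs_inv E k n off dead en0 v b0 b1 b2 cur sc (arr s aLay) (arr s aQ) (arr s aPar)
    (arr s aCell) (arr s aEnd) lo (var s vF) (var s vT).

Definition ends (s : state) := \sum_(x < n) arr s aEnd x.

Lemma scan_vertexP dead en0 v b0 b1 b2 cur lo s : env s ->
  bfs_at dead en0 v b0 b1 b2 cur (var s vH) lo s ->
  scanned off (arr s aQ) (arr s aEnd) lo (var s vH) ->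
  b1 <= var s vH < b2 -> var s vC = cur -> var s vS = cur.+1 -> cur < k.+2 ->
  spec scan_vertex s (fun t s' => [/\
    exists lo', bfs_at dead en0 v b0 b1 b2 cur (var s vH).+1 lo' s' /\
      scanned off (arr s' aQ) (arr s' aEnd) lo' (var s vH).+1,
    var s' vH = (var s vH).+1,
    t + 10 * ends s' + 10 * var s vT <= 10 * ends s + 10 * var s' vT + 6 &
    var s' vT + off (arr s aQ (var s vH)) =
      var s vT + arr s' aEnd (arr s aQ (var s vH))]).
Proof.
move=> [sN sZ sO sOff] inv [sc1 sc2] hb sC sS ck.
set h := var s vH in inv sc1 sc2 hb *; set x := arr s aQ h.
have htl : h < var s vT by have [? ? ? ? ?] := bi_pos inv; lia.
have xn : x < n := bi_queue inv htl.
have [xp1 xp2 xp3 xp4] := bi_ptr inv xn.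
have lox : lo x = off x.
  by apply: sc2 => i ih qi; have := bi_inj inv _ htl qi; lia.
rewrite /scan_vertex.
do 3 step_instr.
apply: spec_seq.
set s1 := set_var _ _ _.
have s1X : var s1 vX = x by [].
have s1R : var s1 vR = off x by rewrite /= sOff.
have s1E : var s1 vE = arr s aEnd x by [].
pose I t (u : state) :=
  [/\ bfs_inv E k n off dead en0 v b0 b1 b2 cur h.+1 (arr u aLay) (arr u aQ)
        (arr u aPar) (arr u aCell) (upd (arr s aEnd) x (var u vE))
        (upd lo x (var u vR)) (var u vF) (var u vT),
      forall i, i <= h -> arr u aQ i = arr s aQ i,
      off x <= var u vR <= var u vE /\ var u vE <= arr s aEnd x,
      t <= 10 * (var u vR - off x) + 10 * (arr s aEnd x - var u vE) &
      var u vT + off x = var s vT + var u vR].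
apply: spec_conseq.
  apply: (@spec_while _ _ I (fun u => var u vE - var u vR)).
    rewrite /I s1R s1E !upd_id //; split=> //=; try lia.
    by apply: (bfs_inv_sc inv); lia.
  move=> t u [frv fra] [iu qu [bu1 bu2] tu Tu] /= lt.
  have uX : var u vX = x by rewrite frv.
  have uZ : var u vZ = 0 by rewrite frv.
  have uC : var u vC = cur by rewrite frv.
  have uS : var u vS = cur.+1 by rewrite frv.
  have qx : arr u aQ h = x by rewrite qu.
  have hsc : h < h.+1 by [].
  have lt' : upd lo x (var u vR) x < upd (arr s aEnd) x (var u vE) x by rewrite !updE.
  have yE : arr u aCell (var u vR) = arr u aCell (upd lo x (var u vR) x).
    by rewrite updE.
  rewrite /scan_cell; do 2 step_instr.
  apply: spec_if => /= [ly|ly].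
    have ly0 : arr u aLay (arr u aCell (var u vR)) = 0 by lia.
    have := bfs_keep Esym Elt iu hb qx hsc lt' yE ly0.
    rewrite updE upd_upd => iu'.
    do 4 step_instr; apply: spec_do.
    rewrite /I [step _ _]/= /=; split; first lia.
    split; try lia.
    by move: iu'; rewrite -uS -uX.
    move=> i ih; rewrite ifN; first exact: qu.
    by have [? ? ? ? ?] := bi_pos iu; lia.
  have ly0 : arr u aLay (arr u aCell (var u vR)) <> 0 by lia.
  have := bfs_delete Esym Eirr Elt no_odd_cycle off_mono iu hb qx hsc lt' yE ly0 ck.
  rewrite !updE upd_upd => iu'.
  apply: spec_seq; apply: spec_if => /= lC; apply: spec_do;
    do 2 step_instr; apply: spec_do.
    rewrite /I [step _ _]/= /=; split; first lia.
    split=> //; try lia.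
    by move: iu'; rewrite ifT // -uC.
  rewrite /I [step _ _]/= /=; split; first lia.
  split=> //; try lia.
  by move: iu'; rewrite ifN // -uC.
move=> t u [frv fra] [[iu qu [bu1 bu2] tu Tu] t0 /= lt].
have uX : var u vX = x by rewrite frv.
have uH : var u vH = h by rewrite frv.
have uE : arr u aEnd = arr s aEnd by rewrite fra.
have uRE : var u vR = var u vE by lia.
step_instr; apply: spec_do.
rewrite [step _ _]/=.
set u' := set_var _ _ _.
have endE : arr u' aEnd = upd (arr s aEnd) x (var u vE) by rewrite -uX -uE.
split; rewrite ?endE ?updE.
- exists (upd lo x (var u vR)); rewrite /bfs_at endE; split=> //.
  have -> : arr u' aQ = arr u aQ by [].
  split=> [i ih|y hy].
    have [->|ix] := eqVneq i h; first by rewrite qu // !updE.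
    have ih' : i < h by lia.
    have qix : arr u aQ i <> x.
      rewrite qu; last lia.
      by move=> qi; have := bi_inj inv _ htl qi; lia.
    by rewrite !updN // qu ?sc1 //; lia.
  have yx : y <> x by move=> yx; apply: (hy h) => //; rewrite qu.
  by rewrite updN //; apply: sc2 => i ih; rewrite -qu; [apply: hy|]; lia.
- by rewrite /= uH.
- rewrite /ends endE /=.
  have := sum_upd (arr s aEnd) (var u vE) xn.
  set S' := \sum_(i < n) upd _ _ _ _; set S := \sum_(i < n) _.
  by move: S S' => S S'; lia.
- by rewrite /=; lia.
Qed.

Lemma env_frame P s s' : frame P s s' ->
  [&& ~~ writes_var P vN, ~~ writes_var P vZ, ~~ writes_var P vO &
      ~~ writes_arr P aOff] -> env s -> env s'.
Proof.
move=> [fv fa] /and4P[pN pZ pO pA] [sN sZ sO sA].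
by split; rewrite ?fv ?fa.
Qed.

Lemma scan_layerP dead en0 v b0 b1 b2 cur lo D s : env s ->
  bfs_at dead en0 v b0 b1 b2 cur b1 lo s ->
  scanned off (arr s aQ) (arr s aEnd) lo b1 ->
  var s vH = b1 -> var s vB2 = b2 ->
  var s vC = cur -> var s vS = cur.+1 -> cur < k.+2 ->
  (forall x, x < n -> ~~ dead x -> en0 x <= off x + D) ->
  spec scan_layer s (fun t s' => [/\
    exists lo', bfs_at dead en0 v b0 b1 b2 cur b2 lo' s' /\
      scanned off (arr s' aQ) (arr s' aEnd) lo' b2,
    var s' vH = b2,
    t + 10 * ends s' + 10 * var s vT <=
      10 * ends s + 10 * var s' vT + 7 * (b2 - b1) + 1,
    var s vT <= var s' vT <= var s vT + D * (b2 - b1) &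
    b1 = 0 -> b2 = 1 -> var s' vT + off v = var s vT + arr s' aEnd v]).
Proof.
move=> es inv sc sH sB2 sC sS ck leD.
pose I t (u : state) := [/\
  exists lo', bfs_at dead en0 v b0 b1 b2 cur (var u vH) lo' u /\
      scanned off (arr u aQ) (arr u aEnd) lo' (var u vH),
  b1 <= var u vH <= b2,
  t + 10 * ends u + 10 * var s vT <=
    10 * ends s + 10 * var u vT + 7 * (var u vH - b1),
  var s vT <= var u vT <= var s vT + D * (var u vH - b1) &
  b1 = 0 -> var u vH = 1 -> var u vT + off v = var s vT + arr u aEnd v].
apply: spec_conseq.
  apply: (@spec_while _ _ I (fun u => var u vB2 - var u vH)).
    rewrite /I sH; split; try lia.
      by exists lo.
    by have [? ? ? ? ?] := bi_pos inv; lia.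
  move=> t u fr [[lo' [iu scu]] hu tu Tu ru] /= lt.
  have eu : env u by apply: env_frame fr _ es.
  have [frv fra] := fr.
  have uB : var u vB2 = b2 by rewrite frv.
  apply: spec_conseq.
    apply: (scan_vertexP (v := v) (b0 := b0) (b1 := b1) (b2 := b2) eu iu scu) => //.
    - by lia.
    - by rewrite frv.
    - by rewrite frv.
  move=> t' u' [frv' fra'] [iu' hu' tu' Tu'].
  have uB' : var u' vB2 = b2 by rewrite frv'.
  have htl : var u vH < var u vT by have [? ? ? ? ?] := bi_pos iu; lia.
  have xn := bi_queue iu htl.
  set x := arr u aQ (var u vH) in Tu' xn.
  have xD : ~~ dead x.
    by rewrite -(bi_dead iu); have [? _ _ _ _] := bi_lay iu htl; rewrite /x; lia.
  have [lo'' [jnv _]] := iu'.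
  have [? ? ? ?] := bi_ptr jnv xn; have := leD x xn xD => ?.
  split; first lia.
  rewrite /I hu'; split=> //; try lia.
    have -> : (var u vH).+1 - b1 = (var u vH - b1).+1 by lia.
    by rewrite mulnS; lia.
  move=> b10 h1; have h0 : var u vH = 0 by lia.
  have xv : x = v by rewrite /x h0; case: (bi_root iu).
  rewrite xv in Tu'.
  by move: Tu; rewrite h0; lia.
move=> t s' [frv fra] [[iu hu tu Tu ru] t0 /= lt].
have sB' : var s' vB2 = b2 by rewrite frv.
have hE : var s' vH = b2 by lia.
rewrite hE in iu tu Tu ru.
split=> //; lia.
Qed.

Lemma mark_untilP b c s : var s vH <= var s b ->
  [&& b != vH, b != vX, c != vH & c != vX] ->
  spec (mark_until b c) s (fun t s' => [/\ t <= 4 * (var s b - var s vH) + 1,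
    var s' vH = var s b,
    forall i, var s vH <= i < var s b -> arr s' aLay (arr s aQ i) = var s c &
    forall y, (forall i, var s vH <= i < var s b -> arr s aQ i <> y) ->
      arr s' aLay y = arr s aLay y]).
Proof.
move=> le /and4P[bH bX cH cX].
pose I t (u : state) := [/\ t <= 4 * (var u vH - var s vH),
  var s vH <= var u vH <= var s b,
  forall i, var s vH <= i < var u vH -> arr u aLay (arr s aQ i) = var s c &
  forall y, (forall i, var s vH <= i < var u vH -> arr s aQ i <> y) ->
    arr u aLay y = arr s aLay y].
apply: spec_conseq.
  apply: (@spec_while _ _ I (fun u => var s b - var u vH)).
    by split=> //; lia.
  move=> t u [frv fra] [tu hu mu nu] /= lt.
  have ub : var u b = var s b.
    by rewrite frv //=; apply/norP; split;
      [move: bX | move: bH]; apply: contra => /eqP[<-].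
  have uc : var u c = var s c.
    by rewrite frv //=; apply/norP; split;
      [move: cX | move: cH]; apply: contra => /eqP[<-].
  have uq : arr u aQ = arr s aQ by rewrite fra.
  do 2 step_instr; apply: spec_do.
  rewrite /I [step _ _]/= /= (negPf cX) uc uq; rewrite ub in lt.
  split; first lia.
  split; try lia.
    move=> i ih; case: eqP => // ne; apply: mu.
    have [ih'|] := eqVneq i (var u vH); last lia.
    by rewrite ih' in ne.
  move=> y hy; case: eqP => [yE|_].
    by case: (hy (var u vH)) => //; lia.
  by apply: nu => i ih; apply: hy; lia.
move=> t s' [frv fra] [[tu hu mu nu] t0 /= lt].
have ub : var s' b = var s b.
    by rewrite frv //=; apply/norP; split;
      [move: bX | move: bH]; apply: contra => /eqP[<-].
have hE : var s' vH = var s b by lia.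
by rewrite hE in tu mu nu; split=> //; lia.
Qed.

Lemma sum_mark m (q f g : nat -> nat) : (forall i, i < m -> q i < n) ->
  (forall i j, i < m -> j < m -> q i = q j -> i = j) ->
  (forall i, i < m -> f (q i) = 0 /\ g (q i) = 1) ->
  (forall y, (forall i, i < m -> q i <> y) -> g y = f y) ->
  \sum_(x < n) g x = \sum_(x < n) f x + m.
Proof.
elim: m g => [|m IH] g qn inj fg eqg.
  by rewrite addn0; apply: eq_bigr => i _; apply: eqg.
have qm i : i < m -> q i <> q m by move=> im /inj; lia.
have := sum_upd g 0 (qn m (ltnSn m)); rewrite (IH (upd g (q m) 0)).
- by have [_ ->] := fg m (ltnSn m); lia.
- by move=> i im; apply: qn; lia.
- by move=> i j im jm; apply: inj; lia.
- by move=> i im; rewrite updN; [apply: fg; lia | exact: qm].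
- move=> y hy; case: (updP g (q m) 0 y) => -[ym ->].
    by rewrite ym; have [-> _] := fg m (ltnSn m).
  apply: eqg => i im; have [->|im'] := eqVneq i m; first by move=> /esym.
  by apply: hy; lia.
Qed.

Definition root_at (s : state) : Prop :=
  root_inv E n off (arr s aLay) (arr s aCell) (arr s aEnd) (var s vF).

Definition deaths (s : state) := \sum_(x < n) arr s aLay x.

Lemma clusterP D s : 2 <= k -> env s -> root_at s -> var s vV < n ->
  arr s aLay (var s vV) = 0 ->
  arr s aPow 0 = 0 -> n <= arr s aPow k ->
  (forall x, x < n -> arr s aLay x = 0 -> arr s aEnd x <= off x + D) ->
  spec cluster s (fun t s' => [/\ root_at s',
    forall x, x < n -> arr s' aEnd x <= arr s aEnd x,
    forall x, arr s aLay x = 1 -> arr s' aLay x = 1 &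
    exists J b0 b2, [/\
      t + 10 * ends s' <= 10 * ends s + 25 * b2 + 10 * k + 20,
      deaths s' = deaths s + b0,
      1 <= J <= k /\ b2 <= arr s aPow J,
      J = 1 -> (arr s' aEnd (var s vV)).+1 = off (var s vV) + b2 &
      [/\ 2 <= J -> arr s aPow (J - 2) < b0 /\ arr s' aLay (var s vV) = 1 &
          3 <= J -> arr s aPow 2 < 1 + D + D * D]]]).
Proof.
move=> k2 es rs vn lv pow0 powk leD.
rewrite /cluster.
do 11 step_instr.
apply: spec_seq; set v := var s vV in vn lv *.
match goal with |- spec _ ?x _ => set s1 := x end.
have [inv1 sc1] := bfs_start k (arr s aQ) (arr s aPar) rs vn lv.
have es1 : env s1 by case: es.
have s1Q : arr s1 aQ = upd (arr s aQ) 0 v.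
  by case: es => [_ sZ _ _]; rewrite -[LHS]/(upd (arr s aQ) (var s vZ) v) sZ.
have ends1 : ends s1 = ends s by [].
pose dead y := arr s aLay y == 1.
have lay0 x : ~~ dead x -> arr s aLay x = 0.
  by have := ri_lay rs x; rewrite /dead; lia.
pose I t (u : state) := exists lo b0 b1,
  [/\ bfs_at dead (arr s aEnd) v b0 b1 (var u vB2) (var u vJ).+2 b1 lo u,
      scanned off (arr u aQ) (arr u aEnd) lo b1,
      [/\ var u vB0 = b0, var u vB1 = b1, var u vH = b1, var u vT = var u vB2 &
          [/\ var u vC = (var u vJ).+2, var u vS = (var u vJ).+3,
              var u vP = arr s aPow (var u vJ) & var u vJ <= k]],
      t + 10 * ends u <= 10 * ends s + 10 * var u vT + 7 * b1 + 10 * var u vJ &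
      [/\ var u vJ = 0 -> [/\ b0 = 0, b1 = 0 & var u vB2 = 1],
          var u vJ = 1 ->
            [/\ b0 = 0, b1 = 1, (arr u aEnd v).+1 = off v + var u vB2 &
                var u vB2 <= D.+1],
          var u vJ = 2 -> var u vB2 <= 1 + D + D * D,
          1 <= var u vJ -> arr s aPow (var u vJ - 1) < b1 &
          [/\ 2 <= var u vJ -> arr s aPow (var u vJ - 2) < b0 &
              3 <= var u vJ -> arr s aPow 2 < 1 + D + D * D]]].
apply: spec_conseq.
  apply: (@spec_while _ _ I (fun u => k - var u vJ)).
    exists off, 0, 0; split=> //=; try lia.
    by move: inv1; rewrite -s1Q.
  move=> t u fr [lo [b0 [b1 [iu su [uB0 uB1 uH uT [uC uS uP uJ]] tu]]]].
  move=> [c0 c1 c2 c3 [c4 c5]] /= lt.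
  have eu : env u by apply: env_frame fr _ es1.
  have [frv fra] := fr.
  have b2n : var u vB2 <= n.
    by rewrite -uT; exact: bfs_size iu.
  have jk : var u vJ < k.
    rewrite ltn_neqAle uJ andbT; apply/eqP => jk; rewrite jk in uP.
    by lia.
  apply: spec_seq; apply: spec_conseq.
    apply: (scan_layerP (D := D) eu iu su) => //.
    by move=> x xn /lay0; apply: leD.
  move=> t' u' [frv' fra'] [[lo' [iu' su']] uH' tu' Tu' v0].
  have uB1' : var u' vB1 = b1 by rewrite frv'.
  have uB2' : var u' vB2 = var u vB2 by rewrite frv'.
  have uJ' : var u' vJ = var u vJ by rewrite frv'.
  have uC' : var u' vC = (var u vJ).+2 by rewrite frv'.
  have uS' : var u' vS = (var u vJ).+3 by rewrite frv'.
  have uW' : arr u' aPow = arr s aPow by rewrite fra' // fra.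
  have [bb1 bb2 bb3 bb4 [bb5 bb6]] := bi_pos iu'.
  have iu'' := bfs_next_layer iu' (jk : (var u vJ).+2 < k.+2).
  do 6 step_instr; apply: spec_do.
  rewrite [step _ _]/= /= uJ' uB1' uB2'; split; first lia.
  exists lo', b1, (var u vB2); split=> //=; rewrite ?uJ' ?uB1' ?uB2' ?uC' ?uS' ?uW' //.
  - by rewrite -[ends (set_var _ _ _)]/(ends u'); lia.
  - split=> //.
    + move=> j1; have j0 : var u vJ = 0 by lia.
      have [b00 b10 b21] := c0 j0; rewrite b21; split=> //.
        by have := v0 b10 b21; lia.
      by rewrite b10 b21 in Tu'; lia.
    + move=> j2; have j1 : var u vJ = 1 by lia.
      have [b00 b11 _ leb2] := c1 j1; have : D * (var u vB2 - b1) <= D * D.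
        by rewrite leq_mul2l; lia.
      by lia.
    + by move=> _; rewrite subn1 /=; lia.
    + split.
        by move=> j2; rewrite subSS; apply: c3; lia.
      move=> j3; have [j2|j2] := eqVneq (var u vJ) 2; last by apply: c5; lia.
      by have := c2 j2; rewrite j2 in uP; lia.
move=> t u [frv fra] [[lo [b0 [b1 [iu su [uB0 uB1 uH uT eqs] tu cs]]]] t0 /= lt].
move: eqs cs => [uC uS uP uJ] [c0 c1 c2 c3 [c4 c5]].
have [bb1 bb2 bb3 bb4 [bb5 bb6]] := bi_pos iu.
step_instr.
set u1 := set_var _ _ _.
apply: spec_seq; apply: spec_conseq; first by apply: mark_untilP.
move=> t1 u2 [frv2 fra2] [tu2 uH2 mu2 nu2].
have u2B0 : var u2 vB0 = b0 by rewrite frv2.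
have u2B2 : var u2 vB2 = var u vB2 by rewrite frv2.
have u2Q : arr u2 aQ = arr u aQ by rewrite fra2.
apply: spec_conseq.
  by apply: mark_untilP => //; rewrite uH2 u2B2 /= uB0; lia.
move=> t2 u3 [frv3 fra3] [tu3 uH3 mu3 nu3].
have uO : var u1 vO = 1 by rewrite /= frv //; case: es.
have uZ : var u2 vZ = 0 by rewrite frv2 //= frv //; case: es.
rewrite uO /= uB0 in mu2 nu2 uH2 tu2; rewrite uZ uH2 u2B2 u2Q in mu3 nu3 tu3.
set q := arr u aQ in mu2 nu2 mu3 nu3.
have inj : forall i j, i < var u vB2 -> j < var u vB2 -> q i = q j -> i = j.
  by rewrite -uT; exact: bi_inj iu.
have killE i : i < b0 -> arr u3 aLay (q i) = 1.
  move=> ib; rewrite nu3; first by apply: mu2.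
  by move=> j jb /inj; lia.
have resetE i : b0 <= i < var u vB2 -> arr u3 aLay (q i) = 0 by exact: mu3.
have otherE y : (forall i, i < var u vB2 -> q i <> y) -> arr u3 aLay y = arr u aLay y.
  by move=> hy; rewrite nu3 ?nu2 // => i ib; apply: hy; lia.
have freshE i : i < var u vB2 -> arr s aLay (q i) = 0.
  move=> ib; apply: lay0; rewrite -(bi_dead iu).
  have [|l2 _ _ _ _] := bi_lay iu (i := i); first by rewrite uT.
  by rewrite -/q in l2; lia.
have keepE y : (forall i, i < b0 -> q i <> y) -> arr u3 aLay y = arr s aLay y.
  move=> hy; case: (ltnP (arr u aLay y) 2) => ly.
    rewrite otherE; last first.
      move=> i ib qy; have [|l2 _ _ _ _] := bi_lay iu (i := i); first by rewrite uT.
      by rewrite -/q qy in l2; lia.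
    by have := bi_dead iu y; have := ri_lay rs y; rewrite /dead; lia.
  have [i ib qi] := bi_mem iu ly; rewrite -/q in qi; rewrite uT in ib.
  have [ib0|ib0] := ltnP i b0; first by case: (hy i).
  by rewrite -qi resetE ?freshE //; lia.
have u3C : arr u3 aCell = arr u aCell by rewrite fra3 // fra2.
have u3E : arr u3 aEnd = arr u aEnd by rewrite fra3 // fra2.
have u3F : var u3 vF = var u vF by rewrite frv3 // frv2.
have J0 : 0 < var u vJ.
  by rewrite lt0n; apply/eqP => J0; have [_ _ b21] := c0 J0; rewrite J0 in uP; lia.
split.
- rewrite /root_at u3C u3E u3F.
  apply: (bfs_finish Esym Eirr Elt no_odd_cycle iu su) => //; rewrite uT //.
- by move=> x xn; rewrite u3E; have [] := bi_ptr iu xn.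
- move=> x lx; rewrite keepE // => i ib qx.
  by have := freshE i; rewrite qx lx; lia.
- exists (var u vJ), b0, (var u vB2); split.
  + by have -> : ends u3 = ends u by [rewrite /ends u3E]; lia.
  + rewrite /deaths; apply: (@sum_mark b0 q) => //.
    * by move=> i ib; apply: (bi_queue iu); lia.
    * by move=> i j ib jb; apply: inj; lia.
    * by move=> i ib; split; [apply: freshE; lia | apply: killE].
  + by lia.
  + by move=> J1; have [_ _ + _] := c1 J1; rewrite u3E.
  + split; last exact: c5.
    move=> J2; have ? := c4 J2; split=> //.
    by rewrite -(proj1 (bi_root iu)) killE //; lia.
Qed.

End Scan.

Lemma multiplyP s : var s vQ = 0 -> var s vI = 0 ->
  spec (While (Lt vI vP)
          (Const vM 0 ;; While (Lt vM vD) (Incr vQ ;; Incr vM) ;; Incr vI)) s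
    (fun t s' => t <= var s vP * (3 * var s vD + 4) + 1 /\
                 var s' vQ = var s vP * var s vD).
Proof.
move=> sQ sI.
pose I t (u : state) := [/\ t <= var u vI * (3 * var s vD + 4),
  var u vQ = var u vI * var s vD & var u vI <= var s vP].
apply: spec_conseq.
  apply: (@spec_while _ _ I (fun u => var s vP - var u vI)).
    by rewrite /I sQ sI.
  move=> t u [frv _] [tu Qu Iu] /= lt.
  have uD : var u vD = var s vD by rewrite frv.
  have uP : var u vP = var s vP by rewrite frv.
  step_instr; apply: spec_seq.
  pose I' t (w : state) := [/\ t = 3 * var w vM,
    var w vQ = var u vQ + var w vM & var w vM <= var s vD].
  apply: spec_conseq.
    apply: (@spec_while _ _ I' (fun w => var s vD - var w vM)).
      by rewrite /I' /= addn0.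
    move=> t1 w [frw _] [tw Qw Mw] /= lw.
    have wD : var w vD = var s vD by rewrite frw.
    by apply: spec_seq; do 2 apply: spec_do; rewrite /I' /=; split; [|split]; lia.
  move=> t1 w [frw _] [[tw Qw Mw] t10 /= lw].
  have wD : var w vD = var s vD by rewrite frw.
  have wI : var w vI = var u vI by rewrite frw.
  apply: spec_do; rewrite /I /= wI; split; first lia.
  by split; rewrite ?mulSn; lia.
move=> t u [frv _] [[tu Qu Iu] t0 /= lt].
have uP : var u vP = var s vP by rewrite frv.
have uI : var u vI = var s vP by lia.
by rewrite uI in tu Qu; split=> //; lia.
Qed.

Lemma powersP k s : 0 < k -> var s vK = k -> var s vP = 0 -> var s vD = 0 ->
  (forall j, arr s aPow j = 0) ->
  spec powers s (fun t s' => let d := var s' vD in [/\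
    t <= d * ((14 * k + 5) * d ^ k) + 1,
    var s vN <= d ^ k,
    d = 0 \/ d.-1 ^ k < var s vN,
    arr s' aPow 0 = 0 &
    forall j, 1 <= j <= k -> arr s' aPow j = d ^ j]).
Proof.
move=> k0 sK sP sD sA.
pose I t (u : state) := let d := var u vD in
  [/\ t <= d * ((14 * k + 5) * d ^ k), var u vP = d ^ k,
    d = 0 \/ d.-1 ^ k < var s vN, arr u aPow 0 = 0 &
    forall j, 1 <= j <= k -> arr u aPow j = d ^ j].
apply: spec_conseq.
  apply: (@spec_while _ _ I (fun u => var s vN - var u vD)).
    rewrite /I sD sP sA; split=> //; first by rewrite exp0n.
      by left.
    by move=> j /andP[j0 _]; rewrite sA exp0n.
  move=> t u [frv _] /=; set d := var u vD; move=> [tu Pu du u0 Au] /= lt.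
  have uN : var u vN = var s vN by rewrite frv.
  have uK : var u vK = k by rewrite frv.
  have dlt : d < var s vN.
    rewrite -uN; apply: leq_ltn_trans lt; rewrite Pu.
    by case: (posnP d) => [->//|d0]; rewrite -{1}(expn1 d) leq_pexp2l.
  do 3 step_instr.
  set D := d.+1; have Dk : 0 < D ^ k by rewrite expn_gt0.
  pose I' t (w : state) := [/\ t <= var w vJ * (14 * D ^ k),
    var w vP = D ^ var w vJ, var w vJ <= k, arr w aPow 0 = 0 &
    forall j, 1 <= j <= var w vJ -> arr w aPow j = D ^ j].
  apply: spec_conseq.
    apply: (@spec_while _ _ I' (fun w => k - var w vJ)).
      by rewrite /I' /=; split=> //; lia.
    move=> t1 w [frw _] [tw Pw Jw w0 Aw] /= lw.
    have wD : var w vD = D by rewrite frw.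
    have wK : var w vK = k by rewrite frw.
    do 2 step_instr.
    apply: spec_seq; apply: spec_conseq; first exact: multiplyP.
    move=> t2 w2 [fr2 fra2] /= []; rewrite wD Pw => t2b Q2.
    have J2 : var w2 vJ = var w vJ by rewrite fr2.
    have A2 : arr w2 aPow = arr w aPow by rewrite fra2.
    have le1 : D ^ (var w vJ).+1 <= D ^ k by rewrite leq_pexp2l //; lia.
    do 2 step_instr; apply: spec_do.
    rewrite /I' /= J2 A2 Q2 -expnSr; split; first lia.
    split=> //; try lia.
      rewrite mulSn; suff : t2 <= 7 * D ^ (var w vJ).+1 + 1 by lia.
      apply: leq_trans t2b _; rewrite expnSr leq_add2r mulnCA leq_mul2l.
      by apply/orP; right; rewrite /D; lia.
    by move=> j jj; case: eqP => [->|] // ne; apply: Aw; lia.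
  move=> t1 w [frw _] [[tw Pw Jw w0 Aw] t10 /= lw].
  have wD : var w vD = D by rewrite frw.
  have wK : var w vK = k by rewrite frw.
  have wJ : var w vJ = k by lia.
  rewrite wJ in tw Pw Aw; rewrite wD; split; first by rewrite /D; lia.
  rewrite /I wD; split=> //; last by right; rewrite /D /= -Pu -uN.
  have le1 : d ^ k <= D ^ k by rewrite leq_exp2r.
  have le2 : d * ((14 * k + 5) * d ^ k) <= d * ((14 * k + 5) * D ^ k).
    by rewrite leq_mul2l leq_mul2l le1 !orbT.
  rewrite {1}/D mulSn; move: (leq_trans tu le2) tw Dk.
  set d2 := d * _; move: (D ^ k) d2 => Y d2 tu' tw Y0.
  have -> : (14 * k + 5) * Y = k * (14 * Y) + 5 * Y.
    by rewrite mulnDl mulnA (mulnC k).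
  by move: (k * (14 * Y)) tw => Z tw; lia.
move=> t u [frv _] [[tu Pu du u0 Au] t0 /= lt].
have uN : var u vN = var s vN by rewrite frv.
by split=> //; [lia | rewrite -Pu -uN leqNgt].
Qed.

Section Pass.
Variables (E : rel nat) (k n : nat) (off : nat -> nat).
Hypothesis Esym : symmetric E.
Hypothesis Eirr : irreflexive E.
Hypothesis Elt : forall x y, E x y -> x < n.
Hypothesis no_odd_cycle :
  forall l c, 2 <= l <= k -> size c = 2 * l + 1 -> ~ ucycle E c.
Hypothesis off_mono : forall x y, x <= y -> off x <= off y.
Hypothesis k_ge2 : 2 <= k.

Lemma passP d d1 D s : env n off s -> root_at E n off s ->
  arr s aPow 0 = 0 -> arr s aPow 1 = d1 ->
  (forall j, 2 <= j <= k -> arr s aPow j = d ^ j) -> n <= d ^ k ->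
  d1 = d \/ d1 <= d /\ 1 + D + D * D <= d * d ->
  (forall x, x < n -> arr s aLay x = 0 -> arr s aEnd x <= off x + D) ->
  spec pass s (fun t s' => [/\ root_at E n off s',
    forall x, x < n -> arr s' aLay x = 0 -> arr s' aEnd x < off x + d1 &
    t + 10 * ends n s' + 25 * (d * d) * deaths n s <=
      10 * ends n s + 25 * (d * d) * deaths n s' +
      n * (25 * d + 10 * k + 30) + 2]).
Proof.
move=> es rs p0 p1 pj nk hd leD.
pose R u x := arr u aLay x = 0 -> arr u aEnd x < off x + d1.
pose I t (u : state) := [/\ root_at E n off u, var u vV <= n,
  forall x, x < n -> arr u aEnd x <= arr s aEnd x /\
                     (arr s aLay x = 1 -> arr u aLay x = 1),
  t + 10 * ends n u + 25 * (d * d) * deaths n s <=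
      10 * ends n s + 25 * (d * d) * deaths n u +
      var u vV * (25 * d + 10 * k + 30) &
  forall x, x < var u vV -> R u x].
step_instr; apply: spec_conseq.
  apply: (@spec_while _ _ I (fun u => n - var u vV)).
    set s1 := set_var _ _ _; split=> //.
    by rewrite -[ends n s1]/(ends n s) -[deaths n s1]/(deaths n s); lia.
  move=> t u fr [ru Vu eu tu Ru] /= lt.
  have [frv fra] := fr.
  have envu : env n off u.
    by apply: env_frame fr _ _; last by case: es.
  have [uN uZ uO uOff] := envu.
  have uP : arr u aPow = arr s aPow by rewrite fra.
  have Vn : var u vV < n by rewrite -uN.
  step_instr; set u1 := set_var _ _ _.
  apply: spec_seq; apply: spec_if => /= [|] le; last first.
    apply: spec_do; apply: spec_do.
    set u2 := step _ _; have V2 : var u2 vV = (var u vV).+1 by [].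
    split; first by rewrite V2; lia.
    split=> //.
    - by rewrite V2 mulSn -[ends n u2]/(ends n u) -[deaths n u2]/(deaths n u); lia.
    - rewrite V2 => x; rewrite ltnS leq_eqVlt => /orP[/eqP->|]; last exact: Ru.
      by rewrite /R -[arr u2 aLay]/(arr u aLay); lia.
  apply: spec_conseq.
    apply: (clusterP Esym Eirr Elt no_odd_cycle off_mono (D := D)) => //=.
    - by lia.
    - by rewrite uP.
    - by rewrite uP pj // k_ge2 leqnn.
    - move=> x xn lx; have [h1 h2] := eu x xn; apply: leq_trans h1 (leD x xn _).
      by have := ri_lay rs x; lia.
  move=> t' u' [frv' fra'] [ru' eu' lu' [J [b0 [b2 [tu' du' [Jk b2J] J1 [J2 J3]]]]]].
  apply: spec_do; set u2 := step _ _.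
  have V2 : var u2 vV = (var u vV).+1 by rewrite /= frv'.
  split; first by rewrite V2; lia.
  rewrite -[arr u1 aPow]/(arr u aPow) uP in b2J J2 J3.
  have b2b : b2 <= d * d * b0 + d.
    have [J2e|Jn2] := leqP J 2; last first.
      have J1' : 1 <= J - 2 by lia.
      have [b0J _] := J2 (ltnW Jn2).
      have dd : arr s aPow (J - 2) = d ^ (J - 2).
        case: hd => [d1d|[_ hD]]; last first.
          by have := J3 Jn2; rewrite pj ?k_ge2 // -mulnn; lia.
        have [->|J3'] := eqVneq J 3; first by rewrite p1 d1d expn1.
        by rewrite pj //; lia.
      have bJ : b2 <= d ^ J by rewrite -pj //; lia.
      apply: leq_trans (leq_trans bJ _) (leq_addr _ _).
      have -> : J = (J - 2) + 2 by lia.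
      rewrite expnD mulnC -mulnn leq_mul2l; apply/orP; right.
      by rewrite -dd; lia.
    case: J J1 Jk b2J J2 J2e {J3} => [|[|[|J]]] // J1 Jk b2J J2 _.
      by rewrite p1 in b2J; case: hd => [|[]]; lia.
    have [b00 _] := J2 isT; rewrite subnn p0 in b00.
    rewrite pj ?k_ge2 // -mulnn in b2J.
    by case: b0 b00 {du' J2} => // b0 _; rewrite mulnS; lia.
  split=> //.
  - by rewrite V2; lia.
  - move=> x xn; have [h1 h2] := eu x xn; split; first exact: leq_trans (eu' x xn) h1.
    by move=> /h2; exact: lu'.
  - rewrite V2 mulSn -[ends n u2]/(ends n u') -[deaths n u2]/(deaths n u').
    rewrite -[ends n u1]/(ends n u) in tu'; rewrite -[deaths n u1]/(deaths n u) in du'.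
    rewrite du' mulnDr.
    have : 25 * b2 <= 25 * (d * d) * b0 + 25 * d by lia.
    move: (25 * (d * d) * b0) (25 * (d * d) * deaths n s) tu.
    move: (25 * (d * d) * deaths n u).
    by move=> x3 x1 x2 tu2 xb; lia.
  - rewrite V2 => x; rewrite ltnS leq_eqVlt => /orP[/eqP->|xV].
      move=> lV; rewrite -[arr u2 aEnd]/(arr u' aEnd).
      have [J2e|Jn2] := leqP 2 J; first have [_] := J2 J2e.
        by rewrite -[arr u' aLay _]/(arr u2 aLay (var u vV)) lV.
      have J1e : J = 1 by lia.
      by have := J1 J1e; rewrite J1e p1 in b2J; rewrite /=; lia.
    move=> lx; have xn : x < n by lia.
    apply: leq_ltn_trans (eu' x xn) (Ru x xV _).
    have := ri_lay ru x; case lux: (arr u aLay x) => [|[|?]] // _.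
    by move: lx; rewrite (lu' x).
move=> t u [frv fra] [[ru Vu eu tu Ru] t0 /= lt].
have uN : var u vN = n by rewrite frv //; case: es.
have VE : var u vV = n by lia.
by rewrite VE in tu Ru; split=> //; lia.
Qed.

Lemma init_endsP s : var s vN = n -> var s vV = 0 ->
  (forall x, x <= n -> arr s aOff x = off x) ->
  spec init_ends s (fun t s' =>
    t <= 5 * n + 1 /\ forall x, x < n -> arr s' aEnd x = off x.+1).
Proof.
move=> sN sV sOff.
pose I t (u : state) := [/\ t <= 5 * var u vV, var u vV <= n &
  forall x, x < var u vV -> arr u aEnd x = off x.+1].
apply: spec_conseq.
  apply: (@spec_while _ _ I (fun u => n - var u vV)).
    by rewrite /I sV.
  move=> t u [frv fra] [tu Vu Au] /= lt.
  have uN : var u vN = n by rewrite frv.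
  have uOff : arr u aOff = arr s aOff by rewrite fra.
  do 3 step_instr; apply: spec_do.
  rewrite /I [step _ _]/= /= uOff; split; first lia.
  split; try lia.
  by move=> x xV; case: eqP => [->|ne]; [rewrite sOff //; lia | apply: Au; lia].
move=> t u [frv fra] [[tu Vu Au] t0 /= lt].
have uN : var u vN = n by rewrite frv.
have VE : var u vV = n by lia.
by rewrite VE in tu Au; split=> //; lia.
Qed.

Lemma triangle_programP s : var s vN = n -> (forall x, 1 < x -> var s x = 0) ->
  (forall x, x <= n -> arr s aOff x = off x) ->
  (forall a i, 1 < a -> arr s a i = 0) ->
  (forall x i, x < n -> off x <= i < off x.+1 -> E x (arr s aCell i)) ->
  (forall x y, E x y -> exists2 i, off x <= i < off x.+1 & arr s aCell i = y) ->
  spec (triangle_program k) s (fun t s' =>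
    [/\ var s' vN <= 1, var s' vN = 1 <-> some_triangle E &
    exists d, (d = 0 \/ d.-1 ^ k < n) /\
      t <= 10 * off n + n * (25 * (d * d) + 50 * d + 20 * k + 65) +
           d * ((14 * k + 5) * d ^ k) + 20]).
Proof.
move=> sN sV sOff sA sE Es.
do 2 step_instr.
apply: spec_seq; apply: spec_conseq; first by apply: init_endsP => //=; exact: sV.
move=> t1 s1 [fv1 fa1] [ht1 en1].
apply: spec_seq; apply: spec_conseq.
  apply: (@powersP k); first lia; rewrite ?fv1 //= ?sV //.
  by move=> j; rewrite fa1 //= sA.
move=> t2 s2 [fv2 fa2]; set d := var s2 vD; move=> [ht2 nd dn p0 pj].
have s1N : var s1 vN = n by rewrite fv1.
rewrite s1N in nd dn.
have s2A a : 1 < a -> a != aEnd -> a != aPow -> forall i, arr s2 a i = 0.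
  move=> a1 aE aP i; rewrite fa2 ?fa1 //=.
  exact: sA.
have env2 : env n off s2.
  split; rewrite ?fv2 ?fv1 //= ?sV // => x xn.
  by rewrite fa2 // fa1 // sOff //; exact: ltnW.
have s2C : arr s2 aCell = arr s aCell by rewrite fa2 // fa1.
have s2E x : x < n -> arr s2 aEnd x = off x.+1 by move=> xn; rewrite fa2 // en1.
have root2 : root_at E n off s2.
  have s2F : var s2 vF = 0 by rewrite fv2 // fv1 //= sV.
  split; rewrite ?s2C ?s2F.
  - by move=> x xn; rewrite s2E // leqnn off_mono.
  - by move=> x i xn; rewrite s2E //; exact: sE.
  - by move=> x; rewrite s2A.
  - by [].
  - move=> _ x y [Exy _]; split; first by rewrite s2A.
    by rewrite s2E; [exact: Es | exact: Elt Exy].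
apply: spec_seq; apply: spec_conseq.
  apply: (@passP d d (off n) s2) => //.
  - by rewrite pj ?expn1 //; lia.
  - by move=> j jk; apply: pj; lia.
  - by left.
  - move=> x xn _; rewrite s2E //; apply: leq_trans (leq_addl _ _).
    exact: off_mono.
move=> t3 s3 fr3 [root3 en3 ht3]; have [fv3 fa3] := fr3.
have env3 : env n off s3 by apply: env_frame fr3 _ env2.
do 2 step_instr.
set s4 := set_cell _ _ _ _.
have s4Z : var s3 vZ = 0 by case: env3.
have s3P : arr s3 aPow = arr s2 aPow by rewrite fa3.
apply: spec_seq; apply: spec_conseq.
  apply: (@passP d 0 d.-1 s4) => //.
  - by rewrite /= s3P.
  - move=> j jk; rewrite /= s3P; case: eqP => [j1|_]; first lia.
    by apply: pj; lia.
  - have [d0|d0] := posnP d; [by left | right; split=> //].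
    by rewrite -{3 4}(prednK d0); lia.
  - by move=> x xn lx; have := en3 x xn lx; rewrite /=; lia.
move=> t5 s5 _ [root5 en5 ht5].
apply: spec_do; set s6 := step _ _.
have s6N : var s6 vN = var s5 vF by [].
have dead5 x : x < n -> arr s5 aLay x <> 0.
  by move=> xn lx; have := en5 x xn lx; have := ri_ptr root5 xn; lia.
have [fo1 fot] := ri_found root5.
rewrite s6N; split=> //.
  split=> // -[x [y Txy]]; case: (posnP (var s5 vF)) => [f0|]; last lia.
  have [lx _] := ri_tri root5 f0 Txy.
  by case: (dead5 x) => //; case: Txy => Exy _; exact: Elt Exy.
exists d; split=> //.
have deaths_le : deaths n s5 <= n.
  rewrite -[X in _ <= X](card_ord n) -sum1_card; apply: leq_sum => i _.
  exact: (ri_lay root5).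
have ends5 : ends n s2 <= ends n s5 + off n.
  have le5 : \sum_(x < n) off x <= ends n s5.
    by apply: leq_sum => i _; case/andP: (ri_ptr root5 (ltn_ord i)).
  have : ends n s2 <= \sum_(x < n) off x + off n.
    rewrite /ends (eq_bigr (fun x : 'I_n => off x.+1)); last by move=> i _; exact: s2E.
    rewrite -(big_mkord predT (fun x => off x.+1)) -(big_mkord predT off).
    by rewrite -(big_nat_recr n 0 off) // (big_nat_recl n 0 off) //= leq_addl.
  by lia.
rewrite -[ends n s4]/(ends n s3) -[deaths n s4]/(deaths n s3) in ht5.
have dd : 25 * (d * d) * deaths n s5 <= n * (25 * (d * d)).
  by rewrite mulnC leq_mul2r deaths_le orbT.
have -> : n * (25 * (d * d) + 50 * d + 20 * k + 65) =
  n * (25 * (d * d)) + 2 * (n * (25 * d + 10 * k + 30)) + 5 * n.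
  by lia.
move: dd ht3 ht5 ht2 ends5 ht1.
move: (n * (25 * (d * d))) (n * (25 * d + 10 * k + 30)) (d * ((14 * k + 5) * d ^ k)).
move: (25 * (d * d) * deaths n s5) (25 * (d * d) * deaths n s3).
move: (25 * (d * d) * deaths n s2).
move=> x1 x2 x3 x4 x5 x6 *; rewrite {s6 s6N}.
by lia.
Qed.

End Pass.

(** * Input format and the final bound *)

Section Input.
Variables (n : nat) (e : rel 'I_n) (adj : 'I_n -> seq 'I_n).
Hypotheses (simple_e : simple_graph e) (adj_e : adjacency_lists e adj).

Definition nat_rel : rel nat := fun x y =>
  [exists u : 'I_n, exists w : 'I_n, [&& val u == x, val w == y & e u w]].

Lemma nat_relP x y :
  reflect (exists u w, [/\ val u = x, val w = y & e u w]) (nat_rel x y).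
Proof.
apply: (iffP existsP) => [[u /existsP[w /and3P[/eqP ux /eqP wy ew]]]|].
  by exists u, w.
by move=> [u [w [ux wy ew]]]; exists u; apply/existsP; exists w; rewrite ux wy !eqxx.
Qed.

Lemma nat_rel_val (u w : 'I_n) : nat_rel u w = e u w.
Proof.
apply/nat_relP/idP => [[u' [w' [/val_inj-> /val_inj->]]]|] //.
by move=> ew; exists u, w.
Qed.

Lemma nat_rel_sym : symmetric nat_rel.
Proof.
move=> x y; apply/nat_relP/nat_relP => -[u [w [ux wy ew]]]; exists w, u;
  by split=> //; rewrite (proj1 simple_e).
Qed.

Lemma nat_rel_irr : irreflexive nat_rel.
Proof.
move=> x; apply/nat_relP => -[u [w [ux wy ew]]].
by move: ew; rewrite (_ : u = w) ?(proj2 simple_e) //; apply: val_inj; rewrite ux.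
Qed.

Lemma nat_rel_lt x y : nat_rel x y -> x < n.
Proof. by move=> /nat_relP[u [w [<- _ _]]]; exact: ltn_ord. Qed.

Lemma nat_rel_cycle c : ucycle nat_rel c -> has_cycle_of_length e (size c).
Proof.
case: c => [|x0 c0] uc; first by exists [::].
set c := x0 :: c0 in uc *.
have cn x : x \in c -> x < n.
  move=> xc; case/andP: uc => cy _; exact: nat_rel_lt (next_cycle cy xc).
pose f := insubd (Ordinal (cn x0 (mem_head _ _))).
have fK : {in c, cancel f val} by move=> x /cn xn; rewrite val_insubd xn.
have cE : c = [seq val u | u <- map f c].
  by rewrite -map_comp map_id_in.
exists (map f c); first by rewrite size_map.
move: uc; rewrite {1}cE /ucycle cycle_map (map_inj_uniq val_inj) => /andP[cy ->].
by rewrite andbT; apply: sub_cycle cy => u w /=; rewrite nat_rel_val.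
Qed.

Lemma some_triangle_nat_rel : some_triangle nat_rel <-> has_triangle e.
Proof.
split.
  move=> [x [y [/nat_relP[u [w [<- <- uw]]] [z /nat_relP[w' [t [/val_inj-> <- wt]]]]]]].
  rewrite nat_rel_val => tu; apply/existsP; exists u; apply/existsP; exists w.
  by apply/existsP; exists t; rewrite uw wt.
move=> /existsP[u /existsP[w /existsP[t /and3P[uw wt tu]]]].
by exists u, w; split; [|exists (val t)]; rewrite nat_rel_val.
Qed.

Definition offset (x : nat) := sumn (take x [seq size (adj u) | u <- enum 'I_n]).

Lemma offset_ord (u : 'I_n) : offset u.+1 = offset u + size (adj u).
Proof.
rewrite /offset (take_nth 0) ?sumn_rcons; last first.
  by rewrite size_map size_enum_ord ltn_ord.
by rewrite (nth_map u) ?size_enum_ord ?ltn_ord // nth_ord_enum.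
Qed.

Lemma offset_mono x y : x <= y -> offset x <= offset y.
Proof.
move=> xy; rewrite /offset -(subnKC xy) takeD sumn_cat; exact: leq_addr.
Qed.

Lemma offsetE : offset n = \sum_(u < n) size (adj u).
Proof.
rewrite /offset take_oversize; last by rewrite size_map size_enum_ord.
by rewrite sumnE big_map big_enum.
Qed.

Lemma nth_scanl_addn a s i : i < size s ->
  nth 0 (scanl addn a s) i = a + sumn (take i.+1 s).
Proof.
elim: s a i => // x s IH a [|i] /= si; first by rewrite take0 /= addn0.
by rewrite IH // addnA.
Qed.

Lemma nth_flatten_offset (ss : seq (seq nat)) r c : r < size ss ->
  c < size (nth [::] ss r) ->
  nth 0 (flatten ss) (sumn (take r (map size ss)) + c) = nth 0 (nth [::] ss r) c.
Proof.
elim: ss r => // s ss IH [|r] /= rs cs; first by rewrite nth_cat cs.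
by rewrite nth_cat ltnNge -addnA leq_addr /= addKn IH.
Qed.

Lemma graph_input_offset x : x <= n -> arr (graph_input e adj) 0 x = offset x.
Proof.
rewrite /= /offset -map_comp => xn.
rewrite (eq_map (g := fun u => size (adj u))); last first.
  by move=> u; rewrite /= size_map.
case: x xn => [|x] xn; first by rewrite take0.
by rewrite /= nth_scanl_addn // size_map size_enum_ord.
Qed.

Lemma graph_input_cell (u : 'I_n) j : j < size (adj u) ->
  arr (graph_input e adj) 1 (offset u + j) = nth 0 (map val (adj u)) j.
Proof.
move=> js /=; set ss := map _ _.
have -> : offset u = sumn (take u (map size ss)).
  rewrite /offset /ss -map_comp; congr (sumn (take _ _)).
  by apply: eq_map => w; rewrite /= size_map.
have nE : nth [::] ss u = map val (adj u).
  by rewrite /ss (nth_map u) ?size_enum_ord ?ltn_ord // nth_ord_enum.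
rewrite nth_flatten_offset ?nE //; last by rewrite size_map.
by rewrite /ss size_map size_enum_ord ltn_ord.
Qed.

Lemma handshake : \sum_(u < n) size (adj u) <= 2 * #|edges e|.
Proof.
have -> : \sum_(u < n) size (adj u) = #|[set p : 'I_n * 'I_n | e p.1 p.2]|.
  rewrite -sum1_card (eq_bigl (fun p => true && e p.1 p.2)); last first.
    by move=> p; rewrite inE.
  rewrite -(pair_big_dep predT (fun u w => e u w) (fun _ _ => 1)) /=.
  apply: eq_bigr => u _; have [ua aE] := adj_e u.
  rewrite -(card_uniqP ua) sum1_card; apply: eq_card => w.
  by rewrite aE.
pose f (p : 'I_n * 'I_n) := ([set p.1; p.2], p.1 < p.2).
rewrite -(card_in_imset (f := f)); last first.
  move=> [a b] [c d]; rewrite !inE /= => eab ecd [/setP h lt].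
  have ab : a != b by apply: contraTneq eab => ->; rewrite (proj2 simple_e).
  have := h b; have := h a; rewrite !inE !eqxx orbT /=.
  move=> /esym/orP[/eqP aE|/eqP aE] /esym/orP[/eqP bE|/eqP bE].
  - by rewrite aE bE eqxx in ab.
  - by rewrite aE bE.
  - by move: lt; rewrite aE bE; move: ab; rewrite aE bE -val_eqE /=; lia.
  - by rewrite aE bE eqxx in ab.
rewrite mulnC -card_bool -cardsT -cardsX; apply: subset_leq_card.
apply/subsetP => _ /imsetP[p pe ->]; rewrite inE /= inE andbT.
by apply/imsetP; exists p => //; move: pe; rewrite !inE.
Qed.

End Input.

Local Open Scope ring_scope.

Lemma unary_cost_bound (R : realType) (k n m d t : nat) : (0 < k)%N ->
  (d = 0 \/ d.-1 ^ k < n)%N ->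
  (t <= 20 * m + n * (25 * (d * d) + 50 * d + 20 * k + 65) +
        d * ((14 * k + 5) * d ^ k) + 20)%N ->
  (t%:R : R) <= (385 + 20 * k%:R + (28 * k%:R + 10) * 2 ^+ k) *
                (1 + m%:R + n%:R `^ (1 + 2 / k%:R)).
Proof.
move=> k0 dn; rewrite -(ler_nat R) !(natrD, natrM, natrX) => tb.
apply: le_trans tb _; set K := k%:R; set M := m%:R.
set N := n%:R; set D := d%:R; set P := 2 ^+ k.
have K0 : 0 <= K by exact: ler0n.
have M0 : 0 <= M by exact: ler0n.
have D0 : 0 <= D by exact: ler0n.
have P0 : 0 <= P by apply: exprn_ge0.
have KP0 : 0 <= K * P by apply: mulr_ge0.
have KM0 : 0 <= K * M by apply: mulr_ge0.
have PM0 : 0 <= P * M by apply: mulr_ge0.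
have KPM0 : 0 <= K * P * M by apply: mulr_ge0.
have [n0|n0] := posnP n.
  have dz : d = 0%N by case: dn => //; rewrite n0.
  rewrite /N /D n0 dz powR0; first by lra.
  by rewrite gt_eqF // addr_gt0 // divr_gt0 ?ltr0n.
set y := N `^ k%:R^-1.
have y0 : 0 <= y by apply: powR_ge0.
have yk : y ^+ k = N.
  by rewrite -powR_mulrn // -powRrM mulVf ?powRr1 // pnatr_eq0 -lt0n.
have N1 : 1 <= N by rewrite ler1n.
have y1 : 1 <= y by rewrite -(expr_ge1 k0) // yk.
have Dy : D <= 2 * y.
  case: dn => [dz|dn]; first by rewrite /D dz; lra.
  have : d.-1%:R < y by rewrite -(ltr_pXn2r k0) ?nnegrE // yk -natrX ltr_nat.
  by rewrite /D; case: (d) => [|d'] /=; rewrite -?natr1; lra.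
have wE : N `^ (1 + 2 / k%:R) = N * (y * y).
  rewrite powRD; last by apply/implyP => _; rewrite gt_eqF //; lra.
  rewrite powRr1 ?(mulrC 2); last lra.
  by rewrite powRrM -/y powR_mulrn // expr2.
rewrite wE; set w := N * (y * y).
have yy : y <= y * y by rewrite ler_peMl.
have N0 : 0 <= N by lra.
have DD : N * (D * D) <= 4 * w.
  rewrite /w [leRHS]mulrCA ler_wpM2l //; apply: le_trans (_ : (2 * y) * (2 * y) <= _).
    exact: ler_pM.
  by lra.
have ND : N * D <= 2 * w by rewrite /w [leRHS]mulrCA ler_wpM2l //; lra.
have Nw : N <= w by rewrite /w ler_peMr //; lra.
have KNw : K * N <= K * w by rewrite ler_wpM2l.
have w0 : 0 <= w by lra.
have Dk : D ^+ k <= P * N.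
  by rewrite -yk -exprMn ler_pXn2r ?nnegrE // mulr_ge0.
have cost : D * ((14 * K + 5) * D ^+ k) <= 2 * ((14 * K + 5) * (P * w)).
  apply: le_trans (_ : 2 * (y * y) * ((14 * K + 5) * (P * N)) <= _).
    apply: ler_pM => //; first by rewrite mulr_ge0 ?exprn_ge0 //; lra.
      by lra.
    by rewrite ler_wpM2l //; lra.
  by rewrite /w; lra.
by lra.
Qed.

Theorem theorem9p2 (R : realType) (k : nat) (hk : (2 <= k)%N) :
  exists P : program, combinatorial P /\
  exists C : R,
  forall (n : nat) (e : rel 'I_n) (adj : 'I_n -> seq 'I_n),
    simple_graph e -> adjacency_lists e adj ->
    (forall l : nat, (2 <= l <= k)%N -> ~ has_cycle_of_length e (2 * l + 1)%N) ->
    exists (t : nat) (s : state),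
      [/\ exec P (graph_input e adj) t s,
          output s = has_triangle e :> nat &
          t%:R <= C * (1 + #|edges e|%:R + n%:R `^ (1 + 2 / k%:R))].
Proof.
exists (triangle_program k); split; first exact: combinatorial_triangle_program.
exists (385 + 20 * k%:R + (28 * k%:R + 10) * 2 ^+ k).
move=> n e adj se ae ncyc.
have cells (u : 'I_n) i : (offset adj u <= i < offset adj u.+1)%N ->
    exists2 w, e u w & arr (graph_input e adj) 1 i = val w.
  rewrite offset_ord => iu; have -> : i = (offset adj u + (i - offset adj u))%N by lia.
  set j := (i - _)%N; have js : (j < size (adj u))%N by rewrite /j; lia.
  rewrite graph_input_cell // (nth_map u) //; exists (nth u (adj u) j) => //.
  by rewrite -(proj2 (ae u)) mem_nth.
have spec_main : spec (triangle_program k) (graph_input e adj) (fun t s' =>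
    [/\ (var s' 0 <= 1)%N, var s' 0 = 1%N <-> some_triangle (nat_rel e) &
    exists d, (d = 0 \/ d.-1 ^ k < n)%N /\
      (t <= 10 * offset adj n + n * (25 * (d * d) + 50 * d + 20 * k + 65) +
           d * ((14 * k + 5) * d ^ k) + 20)%N]).
  apply: (triangle_programP (nat_rel_sym se) (nat_rel_irr se)
    (@nat_rel_lt n e) _ (offset_mono adj) hk).
  - move=> l c lk sc uc; apply: (ncyc l lk); rewrite -sc; exact: nat_rel_cycle.
  - by [].
  - by case=> [|[|x]] // _; rewrite /= nth_default.
  - exact: graph_input_offset.
  - by case=> [|[|a]] // i _; rewrite /= !nth_default.
  - move=> x i xn ix; have [w ew ->] := cells (Ordinal xn) i ix.
    by rewrite -[x]/(val (Ordinal xn)) nat_rel_val.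
  - move=> x y /nat_relP[u [w [<- <- ew]]]; move: ew; rewrite -(proj2 (ae u)) => wu.
    exists (offset adj u + index w (adj u))%N.
      by rewrite offset_ord leq_addr ltn_add2l index_mem.
    by rewrite graph_input_cell ?index_mem // (nth_map u) ?index_mem // nth_index.
have [t [s [ex [s1 stri [d [dn tb]]]]]] := spec_main.
exists t, s; split=> //.
  rewrite /output; case: (boolP (has_triangle e)).
    by move=> /some_triangle_nat_rel /stri.
  move=> /negP nt; case: (posnP (var s 0)) => [//|s0].
  by case: nt; apply/some_triangle_nat_rel/stri; lia.
have hs := handshake se ae; rewrite -offsetE in hs.
by apply: unary_cost_bound dn _; lia.
Qed.
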